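(* Let $H$ be a separable Hilbert space, $1\le p<\infty$, and $S$ a compact operator on $H$. The following are equivalent: (a) $S\in S_p$; (b) $\{\langle Se_n,e_n\rangle\}\in\ell^p$ for every orthonormal basis $\{e_n\}$ of $H$; (c) $\{\langle Sf_n,f_n\rangle\}\in\ell^p$ for every frame $\{f_n\}$ of $H$. Furthermore, if $S$ is self-adjoint, then $$\|S\|_p^p=\sup\sum_{n=1}^\infty|\langle Se_n,e_n\rangle|^p=\sup\sum_{n=1}^\infty|\langle Sf_n,f_n\rangle|^p,$$ where the first supremum is over all orthonormal bases and the second over all frames with upper frame bound at most $1$.
   Context: A sequence $\{f_n\}$ in $H$ is a frame if there are constants $0<C_1\le C_2$ such that $C_1\|f\|^2\le\sum_n|\langle f,f_n\rangle|^2\le C_2\|f\|^2$ for all $f\in H$. The upper frame bound is the infimum of all admissible $C_2$. For a compact operator $T$, its singular values $\lambda_1\ge\lambda_2\ge\cdots$ are the positive eigenvalues of $(T^*T)^{1/2}$, repeated according to multiplicity. For $0<p<\infty$, $S_p$ is the set of compact $T$ with $\{\lambda_n\}\in\ell^p$, and $\|T\|_p=(\sum_n\lambda_n^p)^{1/p}$. *)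

(* Defs.v *)
From Stdlib Require Import Reals List.
Open Scope R_scope.

Record C := mkC { Re : R ; Im : R }.
Definition C0 : C := mkC 0 0.
Definition C1 : C := mkC 1 0.
Definition RtoC (r : R) : C := mkC r 0.
Definition Cadd (a b : C) : C := mkC (Re a + Re b) (Im a + Im b).
Definition Cmul (a b : C) : C :=
  mkC (Re a * Re b - Im a * Im b) (Re a * Im b + Im a * Re b).
Definition Cconj (a : C) : C := mkC (Re a) (- Im a).
Definition Cmod (a : C) : R := sqrt (Re a * Re a + Im a * Im a).

Record Hilbert := {
  car :> Type;
  hzero : car;
  hadd : car -> car -> car;
  hopp : car -> car;
  hscal : C -> car -> car;
  inner : car -> car -> C;
  hadd_assoc : forall x y z, hadd x (hadd y z) = hadd (hadd x y) z;
  hadd_comm : forall x y, hadd x y = hadd y x;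
  hadd_zero : forall x, hadd x hzero = x;
  hadd_opp : forall x, hadd x (hopp x) = hzero;
  hscal_addr : forall a x y, hscal a (hadd x y) = hadd (hscal a x) (hscal a y);
  hscal_addl : forall a b x, hscal (Cadd a b) x = hadd (hscal a x) (hscal b x);
  hscal_mul : forall a b x, hscal (Cmul a b) x = hscal a (hscal b x);
  hscal_one : forall x, hscal C1 x = x;
  inner_addl : forall x y z, inner (hadd x y) z = Cadd (inner x z) (inner y z);
  inner_scall : forall a x y, inner (hscal a x) y = Cmul a (inner x y);
  inner_conj : forall x y, inner y x = Cconj (inner x y);
  inner_pos : forall x, 0 <= Re (inner x x);
  inner_def : forall x, inner x x = C0 -> x = hzero;
  hcomplete : forall u : nat -> car,
    (forall eps, 0 < eps -> exists N, forall m n, (N <= m)%nat -> (N <= n)%nat ->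
        sqrt (Re (inner (hadd (u m) (hopp (u n))) (hadd (u m) (hopp (u n))))) < eps) ->
    exists l, forall eps, 0 < eps -> exists N, forall n, (N <= n)%nat ->
        sqrt (Re (inner (hadd (u n) (hopp l)) (hadd (u n) (hopp l)))) < eps
}.
Arguments hzero {_}. Arguments hadd {_} _ _. Arguments hopp {_} _.
Arguments hscal {_} _ _. Arguments inner {_} _ _.

Definition hnorm {H : Hilbert} (x : H) : R := sqrt (Re (inner x x)).
Definition hsub {H : Hilbert} (x y : H) : H := hadd x (hopp y).

Definition hconv {H : Hilbert} (u : nat -> H) (l : H) : Prop :=
  forall eps, 0 < eps -> exists N, forall n, (N <= n)%nat -> hnorm (hsub (u n) l) < eps.

Definition separable (H : Hilbert) : Prop :=
  exists d : nat -> H, forall x eps, 0 < eps -> exists n, hnorm (hsub x (d n)) < eps.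

Definition linear_op {H : Hilbert} (T : H -> H) : Prop :=
  (forall x y, T (hadd x y) = hadd (T x) (T y)) /\
  (forall a x, T (hscal a x) = hscal a (T x)).

Definition compact_op {H : Hilbert} (T : H -> H) : Prop :=
  linear_op T /\
  forall x : nat -> H, (exists B, forall n, hnorm (x n) <= B) ->
    exists (phi : nat -> nat) (y : H),
      (forall n, (phi n < phi (Datatypes.S n))%nat) /\ hconv (fun n => T (x (phi n))) y.

Definition adjoint_of {H : Hilbert} (A B : H -> H) : Prop :=
  forall x y, inner (A x) y = inner x (B y).

Definition self_adjoint {H : Hilbert} (T : H -> H) : Prop := adjoint_of T T.

Definition positive_op {H : Hilbert} (P : H -> H) : Prop :=
  linear_op P /\ self_adjoint P /\ forall x, 0 <= Re (inner (P x) x).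

Definition orthonormal_list {H : Hilbert} (u : list H) : Prop :=
  forall i j, (i < length u)%nat -> (j < length u)%nat ->
    inner (nth i u hzero) (nth j u hzero) = if Nat.eqb i j then C1 else C0.

Fixpoint expand {H : Hilbert} (x : H) (u : list H) : H :=
  match u with
  | nil => hzero
  | v :: u' => hadd (hscal (inner x v) v) (expand x u')
  end.

Definition has_dim {H : Hilbert} (W : H -> Prop) (k : nat) : Prop :=
  exists u : list H, length u = k /\ orthonormal_list u /\
    (forall v, In v u -> W v) /\ (forall x, W x -> x = expand x u).

Definition count_eq (P : nat -> Prop) (k : nat) : Prop :=
  exists l : list nat, NoDup l /\ length l = k /\ forall n, In n l <-> P n.

Fixpoint psum (D : nat -> bool) (a : nat -> R) (N : nat) : R :=
  match N with
  | O => 0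
  | S N' => psum D a N' + (if D N' then a N' else 0)
  end.

(* the (extended, [0,∞]-valued) sum over D of a nonnegative a is <= M *)
Definition esum_le (D : nat -> bool) (a : nat -> R) (M : R) : Prop :=
  forall N, psum D a N <= M.

(* x^p for x >= 0, p > 0 (with 0^p = 0) *)
Definition rpow (x p : R) : R :=
  if Rle_dec x 0 then 0 else Rpower x p.

Definition allN : nat -> bool := fun _ => true.

Definition in_lp (p : R) (D : nat -> bool) (a : nat -> C) : Prop :=
  exists M, esum_le D (fun n => rpow (Cmod (a n)) p) M.

(* an orthonormal basis indexed by {n | D n} (a subset of ℕ: separable H) *)
Definition ONB {H : Hilbert} (D : nat -> bool) (e : nat -> H) : Prop :=
  (forall n m, D n = true -> D m = true ->
     inner (e n) (e m) = if Nat.eqb n m then C1 else C0) /\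
  (forall x, (forall n, D n = true -> inner x (e n) = C0) -> x = hzero).

Definition frame_bounds {H : Hilbert} (f : nat -> H) (C1' C2' : R) : Prop :=
  0 < C1' /\ C1' <= C2' /\
  forall x : H, exists l,
    infinite_sum (fun n => Cmod (inner x (f n)) * Cmod (inner x (f n))) l /\
    C1' * (hnorm x * hnorm x) <= l /\ l <= C2' * (hnorm x * hnorm x).

Definition frame {H : Hilbert} (f : nat -> H) : Prop :=
  exists C1' C2', frame_bounds f C1' C2'.

(* f is a frame whose upper frame bound (infimum of admissible C2) is <= B *)
Definition upper_frame_bound_le {H : Hilbert} (f : nat -> H) (B : R) : Prop :=
  frame f /\
  forall eps, 0 < eps -> exists C1' C2', frame_bounds f C1' C2' /\ C2' < B + eps.

(* (D, s) lists the positive eigenvalues of |T| = (T^*T)^{1/2}, repeated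
   according to multiplicity (order irrelevant for the sums considered) *)
Definition singular_values {H : Hilbert} (T : H -> H) (D : nat -> bool) (s : nat -> R)
  : Prop :=
  exists Tadj P : H -> H,
    adjoint_of T Tadj /\ positive_op P /\ (forall x, P (P x) = Tadj (T x)) /\
    (forall n, D n = true -> 0 < s n) /\
    (forall lam, 0 < lam -> forall k,
        count_eq (fun n => D n = true /\ s n = lam) k <->
        has_dim (fun x => P x = hscal (RtoC lam) x) k).

Definition in_Sp {H : Hilbert} (p : R) (T : H -> H) : Prop :=
  compact_op T /\
  exists D s, singular_values T D s /\ exists M, esum_le D (fun n => rpow (s n) p) M.

(* Main.v *)
Require Import Defs.
From Stdlib Require Import Reals List Lra Lia Classical ClassicalEpsilon IndefiniteDescription.
Import Defs.
Open Scope R_scope.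

(** Let [e_k] be orthonormal eigenvectors of [|S|] for the singular values [s_k], and put
    [sg_k = S e_k / s_k], so that [S x] is the sum of the [s_k <x, e_k> sg_k]. If [f] and [g]
    have Bessel bound 1, then [|<S f_n, g_n>|] is at most the sum over [k] of [s_k w_nk], where
    [w_nk = (|<f_n, e_k>|^2 + |<g_n, sg_k>|^2) / 2]. Bessel's inequality makes [w] doubly
    substochastic, so convexity of [t^p] gives [sum_n |<S f_n, g_n>|^p <= sum_k s_k^p].
    With [g = f] this bounds frame and orthonormal-basis sums by [|S|_p^p]. Conversely, for
    self-adjoint [S] the inequality is applied to the spectral decomposition of [S] and the
    systems [f = e], [g = sg]: it bounds [sum_k s_k^p] by the sum over one eigenbasis of [S].
    A general [S] is split into its real and imaginary parts. *)

(** * Inner products and convergence *)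

(** The two systems [f] and [g] are kept distinct so that one inequality serves both directions. A
    singular value is [<S e_k, sg_k>], in general an off-diagonal entry, while the hypotheses speak
    of diagonal entries only. For self-adjoint [S] the eigenbasis sum dominates all pairs of systems
    with Bessel bound 1, in particular the pair [e], [sg]; so singular values are never matched with
    eigenvalues by a permutation. A general [S] may lack an eigenbasis, which forces the splitting;
    it costs a factor [rpow 2 p], so that argument yields membership in [S_p] but no equality of
    norms. A second obstacle is that [singular_values] provides an arbitrary enumeration with
    counting conditions and no vectors: the [e_k] have to be rebuilt from eigenspace dimensions.
    Finally, every infinite sum is handled through upper bounds on its partial sums, so the value
    infinity needs no separate treatment. *)

Lemma C_ext (a b : C) : Re a = Re b -> Im a = Im b -> a = b.
Proof. destruct a, b; simpl; intros -> ->; reflexivity. Qed.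

(** The squared modulus is polynomial in the coordinates, so [ring] and [nra] apply to it, which the
    square root in [Cmod] would prevent. *)
Definition Csq (a : C) : R := Re a * Re a + Im a * Im a.

Lemma Csq_ge0 (a : C) : 0 <= Csq a.
Proof. unfold Csq; nra. Qed.

Lemma Csq_eq0 (a : C) : Csq a = 0 -> a = C0.
Proof. unfold Csq; intros h; apply C_ext; simpl; nra. Qed.

Lemma Cmod_ge0 (a : C) : 0 <= Cmod a.
Proof. apply sqrt_pos. Qed.

Lemma Cmod_sqr (a : C) : Cmod a * Cmod a = Csq a.
Proof. apply sqrt_sqrt, Csq_ge0. Qed.

Lemma Cmod_C0 : Cmod C0 = 0.
Proof. unfold Cmod; simpl; replace (0 * 0 + 0 * 0) with 0 by ring; apply sqrt_0. Qed.

Lemma Cmod_mul (a b : C) : Cmod (Cmul a b) = Cmod a * Cmod b.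
Proof.
  unfold Cmod; rewrite <- sqrt_mult by (pose proof (Csq_ge0 a); pose proof (Csq_ge0 b); assumption).
  f_equal; simpl; ring.
Qed.

Lemma le_of_sqr_le (a b : R) : 0 <= b -> a * a <= b * b -> a <= b.
Proof. nra. Qed.

Lemma Cmod_triang (a b : C) : Cmod (Cadd a b) <= Cmod a + Cmod b.
Proof.
  pose proof (Cmod_ge0 a); pose proof (Cmod_ge0 b).
  apply le_of_sqr_le; [lra|].
  rewrite Cmod_sqr.
  pose proof (Cmod_sqr a) as ha; pose proof (Cmod_sqr b) as hb.
  assert (hc : Re a * Re b + Im a * Im b <= Cmod a * Cmod b).
  { apply le_of_sqr_le; [nra|].
    replace (Cmod a * Cmod b * (Cmod a * Cmod b))
      with (Cmod a * Cmod a * (Cmod b * Cmod b)) by ring.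
    rewrite ha, hb; unfold Csq.
    pose proof (Rle_0_sqr (Re a * Im b - Im a * Re b)); unfold Rsqr in *; nra. }
  unfold Csq in *; simpl; nra.
Qed.

Lemma Cmod_Re (a : C) : Rabs (Re a) <= Cmod a.
Proof.
  apply le_of_sqr_le; [apply Cmod_ge0|].
  rewrite Cmod_sqr, <- Rabs_mult, Rabs_pos_eq by nra; unfold Csq; nra.
Qed.

Lemma Cmod_Im (a : C) : Rabs (Im a) <= Cmod a.
Proof.
  apply le_of_sqr_le; [apply Cmod_ge0|].
  rewrite Cmod_sqr, <- Rabs_mult, Rabs_pos_eq by nra; unfold Csq; nra.
Qed.

Lemma Cmod_RtoC (r : R) : Cmod (RtoC r) = Rabs r.
Proof. unfold Cmod; simpl; rewrite <- sqrt_Rsqr_abs; f_equal; unfold Rsqr; ring. Qed.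

Lemma Cmod_conj (a : C) : Cmod (Cconj a) = Cmod a.
Proof. unfold Cmod; f_equal; simpl; ring. Qed.

Lemma Cmod_le_small_C0 (a : C) : (forall eps, 0 < eps -> Cmod a <= eps) -> a = C0.
Proof.
  intros h; apply Csq_eq0; rewrite <- Cmod_sqr.
  destruct (Rle_lt_dec (Cmod a) 0) as [h0|h0].
  - pose proof (Cmod_ge0 a); nra.
  - specialize (h (Cmod a / 2) ltac:(lra)); lra.
Qed.

Lemma inner_addr {H : Hilbert} (x y z : H) : inner x (hadd y z) = Cadd (inner x y) (inner x z).
Proof.
  rewrite (inner_conj H (hadd y z) x), inner_addl, (inner_conj H y x), (inner_conj H z x).
  apply C_ext; simpl; ring.
Qed.

Lemma inner_scalr {H : Hilbert} (a : C) (x y : H) :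
  inner x (hscal a y) = Cmul (Cconj a) (inner x y).
Proof.
  rewrite (inner_conj H (hscal a y) x), inner_scall, (inner_conj H y x).
  apply C_ext; simpl; ring.
Qed.

Lemma inner_zerol {H : Hilbert} (x : H) : inner hzero x = C0.
Proof.
  pose proof (inner_addl H hzero hzero x) as h; rewrite hadd_zero in h.
  apply C_ext; [apply (f_equal Re) in h | apply (f_equal Im) in h]; simpl in *; lra.
Qed.

Lemma inner_zeror {H : Hilbert} (x : H) : inner x hzero = C0.
Proof. rewrite (inner_conj H hzero x), inner_zerol; apply C_ext; simpl; ring. Qed.

Lemma inner_oppl {H : Hilbert} (x y : H) : inner (hopp x) y = Cmul (RtoC (-1)) (inner x y).
Proof.
  pose proof (inner_addl H x (hopp x) y) as h; rewrite hadd_opp, inner_zerol in h.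
  apply C_ext; [apply (f_equal Re) in h | apply (f_equal Im) in h]; simpl in *; lra.
Qed.

Lemma inner_oppr {H : Hilbert} (x y : H) : inner x (hopp y) = Cmul (RtoC (-1)) (inner x y).
Proof.
  rewrite (inner_conj H (hopp y) x), inner_oppl, (inner_conj H y x).
  apply C_ext; simpl; ring.
Qed.

Lemma inner_subl {H : Hilbert} (x y z : H) :
  inner (hsub x y) z = Cadd (inner x z) (Cmul (RtoC (-1)) (inner y z)).
Proof. unfold hsub; rewrite inner_addl, inner_oppl; reflexivity. Qed.

Lemma inner_subr {H : Hilbert} (x y z : H) :
  inner z (hsub x y) = Cadd (inner z x) (Cmul (RtoC (-1)) (inner z y)).
Proof. unfold hsub; rewrite inner_addr, inner_oppr; reflexivity. Qed.

Lemma Im_inner_self {H : Hilbert} (x : H) : Im (inner x x) = 0.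
Proof. pose proof (f_equal Im (inner_conj H x x)) as h; simpl in h; lra. Qed.

Create HintDb ip.
#[export] Hint Rewrite @inner_addl @inner_addr @inner_scall @inner_scalr @inner_zerol @inner_zeror
  @inner_oppl @inner_oppr @inner_subl @inner_subr : ip.

Lemma inner_C0_sym {H : Hilbert} (x y : H) : inner x y = C0 -> inner y x = C0.
Proof. intros h; rewrite (inner_conj H x y), h; apply C_ext; simpl; ring. Qed.

Lemma Csq_inner_sym {H : Hilbert} (x y : H) : Csq (inner x y) = Csq (inner y x).
Proof. rewrite (inner_conj H y x); unfold Csq; simpl; ring. Qed.

Lemma hsub_eq0 {H : Hilbert} (x y : H) : hsub x y = hzero -> x = y.
Proof.
  unfold hsub; intros h.
  rewrite <- (hadd_zero H x), <- (hadd_opp H y), (hadd_comm H y), hadd_assoc, h, hadd_comm.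
  apply hadd_zero.
Qed.

Lemma inner_ext {H : Hilbert} (x y : H) : (forall z, inner x z = inner y z) -> x = y.
Proof.
  intros h; apply hsub_eq0, inner_def; rewrite inner_subl, h.
  apply C_ext; simpl; ring.
Qed.

(** Vector identities are tested against all inner products, which turns them into polynomial
    identities between complex coordinates. *)
Ltac hring :=
  apply inner_ext; let z := fresh "z" in intro z; autorewrite with ip;
  apply C_ext; simpl; ring.

Definition nsq {H : Hilbert} (x : H) : R := Re (inner x x).

Lemma nsq_ge0 {H : Hilbert} (x : H) : 0 <= nsq x.
Proof. apply inner_pos. Qed.

Lemma nsq_eq0 {H : Hilbert} (x : H) : nsq x = 0 -> x = hzero.
Proof.
  intros h; apply inner_def, C_ext; [exact h | apply Im_inner_self].
Qed.

Lemma nsq_zero {H : Hilbert} : nsq (@hzero H) = 0.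
Proof. unfold nsq; rewrite inner_zerol; reflexivity. Qed.

Lemma nsq_pos {H : Hilbert} (x : H) : x <> hzero -> 0 < nsq x.
Proof.
  intros h; destruct (nsq_ge0 x) as [h0|h0]; [exact h0|].
  exfalso; apply h, nsq_eq0; congruence.
Qed.

Lemma inner_self {H : Hilbert} (x : H) : inner x x = RtoC (nsq x).
Proof. apply C_ext; [reflexivity | apply Im_inner_self]. Qed.

Lemma nsq_scal {H : Hilbert} (a : C) (x : H) : nsq (hscal a x) = Csq a * nsq x.
Proof.
  unfold nsq; autorewrite with ip; rewrite inner_self; unfold Csq; simpl; ring.
Qed.

Lemma nsq_add {H : Hilbert} (x y : H) :
  nsq (hadd x y) = nsq x + 2 * Re (inner x y) + nsq y.
Proof.
  unfold nsq; autorewrite with ip; rewrite (inner_conj H x y); simpl; ring.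
Qed.

Lemma nsq_sub {H : Hilbert} (x y : H) :
  nsq (hsub x y) = nsq x - 2 * Re (inner x y) + nsq y.
Proof.
  unfold nsq; autorewrite with ip; rewrite (inner_conj H x y); simpl; ring.
Qed.

Lemma nsq_sub_sym {H : Hilbert} (x y : H) : nsq (hsub x y) = nsq (hsub y x).
Proof. rewrite !nsq_sub, (inner_conj H x y); simpl; ring. Qed.

Lemma hscal_zero {H : Hilbert} (a : C) : hscal a (@hzero H) = hzero.
Proof. hring. Qed.

Lemma hnorm_ge0 {H : Hilbert} (x : H) : 0 <= hnorm x.
Proof. apply sqrt_pos. Qed.

Lemma hnorm_sqr {H : Hilbert} (x : H) : hnorm x * hnorm x = nsq x.
Proof. apply sqrt_sqrt, inner_pos. Qed.

Lemma Cauchy_Schwarz_sqr {H : Hilbert} (x y : H) : Csq (inner x y) <= nsq x * nsq y.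
Proof.
  destruct (classic (y = hzero)) as [->|hy].
  - rewrite inner_zeror, nsq_zero; unfold Csq; simpl; lra.
  - pose proof (nsq_pos y hy) as hy0.
    (* The squared norm of this vector is [nsq y] times the defect
       [nsq x * nsq y - Csq (inner x y)]. *)
    pose proof (nsq_ge0 (hsub (hscal (RtoC (nsq y)) x) (hscal (inner x y) y))) as h.
    rewrite nsq_sub, !nsq_scal in h; autorewrite with ip in h.
    unfold Csq in *; simpl in h.
    assert (0 <= nsq y * (nsq x * nsq y
      - (Re (inner x y) * Re (inner x y) + Im (inner x y) * Im (inner x y)))) by nra.
    nra.
Qed.

Lemma Cauchy_Schwarz {H : Hilbert} (x y : H) : Cmod (inner x y) <= hnorm x * hnorm y.
Proof.
  pose proof (hnorm_ge0 x); pose proof (hnorm_ge0 y).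
  apply le_of_sqr_le; [nra|].
  rewrite Cmod_sqr; pose proof (Cauchy_Schwarz_sqr x y) as h.
  rewrite <- !hnorm_sqr in h; nra.
Qed.

Lemma hnorm_triang {H : Hilbert} (x y : H) : hnorm (hadd x y) <= hnorm x + hnorm y.
Proof.
  pose proof (hnorm_ge0 x); pose proof (hnorm_ge0 y).
  apply le_of_sqr_le; [lra|].
  rewrite hnorm_sqr, nsq_add, <- !hnorm_sqr.
  pose proof (Cauchy_Schwarz x y); pose proof (Cmod_Re (inner x y)).
  pose proof (Rle_abs (Re (inner x y))); nra.
Qed.

Lemma hnorm_scal {H : Hilbert} (a : C) (x : H) : hnorm (hscal a x) = Cmod a * hnorm x.
Proof.
  unfold hnorm at 1; change (Re (inner (hscal a x) (hscal a x))) with (nsq (hscal a x)).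
  rewrite nsq_scal, sqrt_mult by (apply Csq_ge0 || apply nsq_ge0); reflexivity.
Qed.

Lemma hnorm_zero {H : Hilbert} : hnorm (@hzero H) = 0.
Proof. unfold hnorm; rewrite inner_zerol; apply sqrt_0. Qed.

Lemma hnorm_sub_sym {H : Hilbert} (x y : H) : hnorm (hsub x y) = hnorm (hsub y x).
Proof. unfold hnorm; f_equal; apply nsq_sub_sym. Qed.

Lemma hnorm_sub_triang {H : Hilbert} (x y z : H) :
  hnorm (hsub x z) <= hnorm (hsub x y) + hnorm (hsub y z).
Proof.
  replace (hsub x z) with (hadd (hsub x y) (hsub y z)) by hring; apply hnorm_triang.
Qed.

Lemma hnorm_eq0 {H : Hilbert} (x : H) : hnorm x = 0 -> x = hzero.
Proof. intros h; apply nsq_eq0; rewrite <- hnorm_sqr, h; ring. Qed.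

Lemma hnorm_small_eq0 {H : Hilbert} (x : H) : (forall eps, 0 < eps -> hnorm x <= eps) -> x = hzero.
Proof.
  intros h; apply hnorm_eq0; destruct (hnorm_ge0 x) as [h0|h0]; [|congruence].
  specialize (h (hnorm x / 2) ltac:(lra)); lra.
Qed.

Lemma hnorm_lt_of_nsq {H : Hilbert} (x : H) (eps : R) :
  0 < eps -> nsq x < eps * eps -> hnorm x < eps.
Proof. intros h; rewrite <- hnorm_sqr; pose proof (hnorm_ge0 x); nra. Qed.

Lemma hnorm_unit {H : Hilbert} (x : H) : nsq x = 1 -> hnorm x = 1.
Proof. rewrite <- hnorm_sqr; pose proof (hnorm_ge0 x); nra. Qed.

Lemma nsq_normalize {H : Hilbert} (x : H) : x <> hzero -> nsq (hscal (RtoC (/ hnorm x)) x) = 1.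
Proof.
  intros h; rewrite nsq_scal, <- hnorm_sqr; unfold Csq; simpl; field.
  intros h0; apply h, hnorm_eq0, h0.
Qed.

Lemma hconv_unique {H : Hilbert} (u : nat -> H) (l m : H) : hconv u l -> hconv u m -> l = m.
Proof.
  intros hl hm; apply hsub_eq0, hnorm_small_eq0; intros eps he.
  destruct (hl (eps / 2) ltac:(lra)) as [N1 h1], (hm (eps / 2) ltac:(lra)) as [N2 h2].
  specialize (h1 (max N1 N2) ltac:(lia)); specialize (h2 (max N1 N2) ltac:(lia)).
  rewrite hnorm_sub_sym in h1.
  pose proof (hnorm_sub_triang l (u (max N1 N2)) m); lra.
Qed.

Lemma hconv_ext {H : Hilbert} (u v : nat -> H) (l : H) :
  (forall n, u n = v n) -> hconv u l -> hconv v l.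
Proof.
  intros h hu eps he; destruct (hu eps he) as [N hN]; exists N; intros n hn.
  rewrite <- h; auto.
Qed.

Lemma hconv_scal {H : Hilbert} (a : C) (u : nat -> H) (l : H) :
  hconv u l -> hconv (fun n => hscal a (u n)) (hscal a l).
Proof.
  intros hu eps he; pose proof (Cmod_ge0 a) as ha.
  assert (hq : 0 < eps / (Cmod a + 1)) by (apply Rdiv_lt_0_compat; lra).
  destruct (hu _ hq) as [N hN]; exists N; intros n hn.
  replace (hsub (hscal a (u n)) (hscal a l)) with (hscal a (hsub (u n) l)) by hring.
  rewrite hnorm_scal; specialize (hN n hn); pose proof (hnorm_ge0 (hsub (u n) l)).
  replace eps with ((Cmod a + 1) * (eps / (Cmod a + 1))) by (field; lra).
  nra.
Qed.

Lemma hconv_of_asymptotic {H : Hilbert} (u v : nat -> H) (l : H) :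
  hconv u l -> hconv (fun n => hsub (v n) (u n)) hzero -> hconv v l.
Proof.
  intros hu hv eps he.
  destruct (hu (eps / 2) ltac:(lra)) as [N1 h1], (hv (eps / 2) ltac:(lra)) as [N2 h2].
  exists (max N1 N2); intros n hn.
  specialize (h1 n ltac:(lia)); specialize (h2 n ltac:(lia)); simpl in h2.
  replace (hsub (hsub (v n) (u n)) hzero) with (hsub (v n) (u n)) in h2 by hring.
  pose proof (hnorm_sub_triang (v n) (u n) l); lra.
Qed.

Lemma strictly_increasing_ge (phi : nat -> nat) :
  (forall n, (phi n < phi (Datatypes.S n))%nat) -> forall n, (n <= phi n)%nat.
Proof. intros h n; induction n; [lia|]; specialize (h n); lia. Qed.

Lemma strictly_increasing_lt (phi : nat -> nat) :
  (forall n, (phi n < phi (Datatypes.S n))%nat) -> forall m n, (m < n)%nat -> (phi m < phi n)%nat.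
Proof. intros h m n hmn; induction hmn; [apply h|]; pose proof (h m0); lia. Qed.

Lemma inner_approx {H : Hilbert} (u : nat -> H) (l x : H) :
  hconv u l -> forall eps, 0 < eps -> exists N, forall n, (N <= n)%nat ->
  Cmod (Cadd (inner (u n) x) (Cmul (RtoC (-1)) (inner l x))) <= eps.
Proof.
  intros hu eps he; pose proof (hnorm_ge0 x) as hx.
  assert (hq : 0 < eps / (hnorm x + 1)) by (apply Rdiv_lt_0_compat; lra).
  destruct (hu _ hq) as [N hN]; exists N; intros n hn; specialize (hN n hn).
  rewrite <- inner_subl.
  pose proof (Cauchy_Schwarz (hsub (u n) l) x); pose proof (hnorm_ge0 (hsub (u n) l)).
  replace eps with ((hnorm x + 1) * (eps / (hnorm x + 1))) by (field; lra).
  nra.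
Qed.

Lemma inner_lim_eq {H : Hilbert} (u v : nat -> H) (l m x y : H) :
  hconv u l -> hconv v m -> (forall n, inner (u n) x = inner (v n) y) -> inner l x = inner m y.
Proof.
  intros hu hv huv.
  cut (Cadd (inner l x) (Cmul (RtoC (-1)) (inner m y)) = C0).
  { intros h; apply C_ext; [apply (f_equal Re) in h | apply (f_equal Im) in h]; simpl in h; lra. }
  apply Cmod_le_small_C0; intros eps he.
  destruct (inner_approx u l x hu (eps / 2) ltac:(lra)) as [N1 h1].
  destruct (inner_approx v m y hv (eps / 2) ltac:(lra)) as [N2 h2].
  set (n := max N1 N2); specialize (h1 n ltac:(lia)); specialize (h2 n ltac:(lia)).
  rewrite huv in h1.
  replace (Cadd (inner l x) (Cmul (RtoC (-1)) (inner m y))) with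
    (Cadd (Cmul (RtoC (-1)) (Cadd (inner (v n) y) (Cmul (RtoC (-1)) (inner l x))))
       (Cadd (inner (v n) y) (Cmul (RtoC (-1)) (inner m y)))) by (apply C_ext; simpl; ring).
  eapply Rle_trans; [apply Cmod_triang|].
  rewrite Cmod_mul, Cmod_RtoC, Rabs_left by lra; lra.
Qed.

Lemma Re_inner_lim_ge0 {H : Hilbert} (u : nat -> H) (l x : H) :
  hconv u l -> (forall n, 0 <= Re (inner (u n) x)) -> 0 <= Re (inner l x).
Proof.
  intros hu h; apply Rnot_lt_le; intros hn.
  destruct (inner_approx u l x hu (- Re (inner l x) / 2) ltac:(lra)) as [N hN].
  specialize (hN N (le_n N)); specialize (h N).
  pose proof (Rle_trans _ _ _ (Cmod_Re _) hN) as hc; simpl in hc.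
  unfold Rabs in hc; destruct Rcase_abs in hc; lra.
Qed.

Lemma hnorm_lim {H : Hilbert} (u : nat -> H) (l : H) :
  hconv u l -> forall eps, 0 < eps ->
  exists N, forall n, (N <= n)%nat -> Rabs (hnorm (u n) - hnorm l) < eps.
Proof.
  intros hu eps he; destruct (hu eps he) as [N hN]; exists N; intros n hn; specialize (hN n hn).
  pose proof (hnorm_triang (hsub (u n) l) l) as h1.
  replace (hadd (hsub (u n) l) l) with (u n) in h1 by hring.
  pose proof (hnorm_triang (hsub l (u n)) (u n)) as h2.
  replace (hadd (hsub l (u n)) (u n)) with l in h2 by hring.
  rewrite hnorm_sub_sym in h2; apply Rabs_def1; lra.
Qed.

(** * Bounded and compact operators *)

Lemma linear_op_sub {H : Hilbert} (T : H -> H) :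
  linear_op T -> forall x y, T (hsub x y) = hsub (T x) (T y).
Proof.
  intros [ha hs] x y.
  replace (hsub x y) with (hadd x (hscal (RtoC (-1)) y)) by hring.
  rewrite ha, hs; hring.
Qed.

Lemma linear_op_zero {H : Hilbert} (T : H -> H) : linear_op T -> T hzero = hzero.
Proof.
  intros hT; replace (@hzero H) with (hsub (@hzero H) hzero) at 1 by hring.
  rewrite (linear_op_sub T hT); hring.
Qed.

Definition bounded_by {H : Hilbert} (T : H -> H) (K : R) : Prop :=
  0 <= K /\ forall x, hnorm (T x) <= K * hnorm x.

(** Otherwise there are [x n] in the unit ball with [T (x n)] of norm above [n], and no subsequence
    of these images can converge. *)
Lemma compact_bounded {H : Hilbert} (T : H -> H) : compact_op T -> exists K, bounded_by T K.
Proof.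
  intros [hl hc]; apply NNPP; intros hn.
  assert (hx : forall n : nat, exists x, hnorm x <= 1 /\ INR n < hnorm (T x)).
  { intros n; apply NNPP; intros hx; apply hn; exists (INR n); split; [apply pos_INR|].
    intros x; apply Rnot_lt_le; intros hlt; apply hx.
    assert (h0 : x <> hzero).
    { intros ->; rewrite (linear_op_zero T hl), hnorm_zero in hlt; lra. }
    assert (hp : 0 < hnorm x).
    { destruct (hnorm_ge0 x) as [?|e]; [assumption|]; exfalso; apply h0, hnorm_eq0; congruence. }
    exists (hscal (RtoC (/ hnorm x)) x); split.
    - rewrite hnorm_unit by (apply nsq_normalize, h0); lra.
    - rewrite (proj2 hl), hnorm_scal, Cmod_RtoC, Rabs_pos_eq
        by (left; apply Rinv_0_lt_compat, hp).
      apply (Rmult_lt_reg_l (hnorm x)); [exact hp|].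
      rewrite <- Rmult_assoc, Rinv_r by lra; lra. }
  apply functional_choice in hx; destruct hx as [x hx].
  destruct (hc x) as [phi [y [hphi hy]]]; [exists 1; intros n; apply hx|].
  destruct (hnorm_lim _ _ hy 1 ltac:(lra)) as [N hN].
  destruct (INR_unbounded (hnorm y + 1)) as [n0 hn0].
  set (n := max N n0); specialize (hN n ltac:(lia)).
  pose proof (proj2 (hx (phi n))) as h1.
  pose proof (le_INR n0 (phi n)) as h2.
  pose proof (strictly_increasing_ge phi hphi n).
  specialize (h2 ltac:(lia)); apply Rabs_def2 in hN; lra.
Qed.

Lemma hconv_image {H : Hilbert} (T : H -> H) (K : R) (u : nat -> H) (l : H) :
  linear_op T -> bounded_by T K -> hconv u l -> hconv (fun n => T (u n)) (T l).
Proof.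
  intros hl [hK hb] hu eps he.
  assert (hq : 0 < eps / (K + 1)) by (apply Rdiv_lt_0_compat; lra).
  destruct (hu _ hq) as [N hN]; exists N; intros n hn; specialize (hN n hn).
  rewrite <- (linear_op_sub T hl).
  pose proof (hb (hsub (u n) l)); pose proof (hnorm_ge0 (hsub (u n) l)).
  replace eps with ((K + 1) * (eps / (K + 1))) by (field; lra); nra.
Qed.

(** * Orthonormal systems *)

(** The common form to which [psum] (after padding with zeros) and [sum_f_R0] (which has one more
    term) are both reduced. *)
Fixpoint rsum (a : nat -> R) (N : nat) : R :=
  match N with O => 0 | Datatypes.S N' => rsum a N' + a N' end.

Lemma rsum_le (a b : nat -> R) (N : nat) :
  (forall n, (n < N)%nat -> a n <= b n) -> rsum a N <= rsum b N.
Proof.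
  induction N as [|N IH]; simpl; intros h; [lra|].
  specialize (h N ltac:(lia)) as h1.
  assert (rsum a N <= rsum b N) by (apply IH; intros; apply h; lia); lra.
Qed.

Lemma rsum_ext (a b : nat -> R) (N : nat) :
  (forall n, (n < N)%nat -> a n = b n) -> rsum a N = rsum b N.
Proof. intros h; apply Rle_antisym; apply rsum_le; intros n hn; rewrite h by exact hn; lra. Qed.

Lemma rsum_plus (a b : nat -> R) (N : nat) :
  rsum (fun n => a n + b n) N = rsum a N + rsum b N.
Proof. induction N; simpl; lra. Qed.

Lemma rsum_scal (c : R) (a : nat -> R) (N : nat) :
  rsum (fun n => c * a n) N = c * rsum a N.
Proof. induction N as [|N IH]; simpl; [|rewrite IH]; lra. Qed.

Lemma rsum_const (c : R) (N : nat) : rsum (fun _ => c) N = INR N * c.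
Proof.
  induction N as [|N IH]; [simpl; lra|].
  rewrite S_INR; simpl rsum; rewrite IH; lra.
Qed.

Lemma rsum_exchange (a : nat -> nat -> R) (N K : nat) :
  rsum (fun n => rsum (a n) K) N = rsum (fun k => rsum (fun n => a n k) N) K.
Proof.
  induction N as [|N IH]; simpl.
  - rewrite rsum_const; ring.
  - rewrite IH, <- rsum_plus; reflexivity.
Qed.

Lemma rsum_mono (a : nat -> R) (N M : nat) :
  (forall n, 0 <= a n) -> (N <= M)%nat -> rsum a N <= rsum a M.
Proof. intros h hNM; induction hNM; simpl; [lra|]; specialize (h m); lra. Qed.

Lemma rsum_ge0 (a : nat -> R) (N : nat) : (forall n, 0 <= a n) -> 0 <= rsum a N.
Proof. intros h; apply (rsum_mono a 0 N h); lia. Qed.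

Lemma rsum_term_le (a : nat -> R) (N n : nat) :
  (forall k, 0 <= a k) -> (n < N)%nat -> a n <= rsum a N.
Proof.
  intros h hn; apply Rle_trans with (rsum a (Datatypes.S n)).
  - simpl; pose proof (rsum_ge0 a n h); lra.
  - apply rsum_mono; [exact h | lia].
Qed.

Lemma rsum_bounded_Cauchy (a : nat -> R) (M : R) :
  (forall n, 0 <= a n) -> (forall N, rsum a N <= M) ->
  forall eps, 0 < eps -> exists N, forall m n, (N <= m)%nat -> (m <= n)%nat ->
  rsum a n - rsum a m < eps.
Proof.
  intros h0 hM eps he.
  destruct (completeness (fun r => exists N, r = rsum a N)) as [l [hub hlub]].
  { exists M; intros r [N ->]; apply hM. }
  { exists (rsum a 0), 0%nat; reflexivity. }
  assert (hN : exists N, l - eps < rsum a N).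
  { apply NNPP; intros hn; apply (Rlt_not_le l (l - eps)); [lra|].
    apply hlub; intros r [N ->]; apply Rnot_lt_le; intros h; apply hn; exists N; exact h. }
  destruct hN as [N hN]; exists N; intros m n hm hn.
  pose proof (rsum_mono a N m h0 hm); pose proof (hub _ (ex_intro _ n eq_refl)); lra.
Qed.

(* Families indexed by a subset of [nat] are padded with [hzero]. *)
Definition ons {H : Hilbert} (e : nat -> H) : Prop :=
  (forall n, e n = hzero \/ nsq (e n) = 1) /\ (forall n m, n <> m -> inner (e n) (e m) = C0).

Definition complete {H : Hilbert} (e : nat -> H) : Prop :=
  forall x, (forall n, inner x (e n) = C0) -> x = hzero.

Lemma ons_nsq_le1 {H : Hilbert} (e : nat -> H) (n : nat) : ons e -> nsq (e n) <= 1.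
Proof. intros [h _]; destruct (h n) as [->| ->]; [rewrite nsq_zero|]; lra. Qed.

Fixpoint comb {H : Hilbert} (c : nat -> C) (e : nat -> H) (N : nat) : H :=
  match N with
  | O => hzero
  | Datatypes.S N' => hadd (comb c e N') (hscal (c N') (e N'))
  end.

Lemma inner_comb_out {H : Hilbert} (c : nat -> C) (e : nat -> H) (N m : nat) :
  ons e -> (N <= m)%nat -> inner (comb c e N) (e m) = C0.
Proof.
  intros he; induction N as [|N IH]; simpl; intros hm; [apply inner_zerol|].
  autorewrite with ip; rewrite IH by lia; rewrite (proj2 he) by lia.
  apply C_ext; simpl; ring.
Qed.

Lemma inner_comb_in {H : Hilbert} (c : nat -> C) (e : nat -> H) (N m : nat) :
  ons e -> (m < N)%nat -> inner (comb c e N) (e m) = Cmul (c m) (inner (e m) (e m)).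
Proof.
  intros he; induction N as [|N IH]; simpl; intros hm; [lia|].
  autorewrite with ip; destruct (PeanoNat.Nat.eq_dec m N) as [->|hne].
  - rewrite inner_comb_out by (auto; lia); apply C_ext; simpl; ring.
  - rewrite IH by lia; rewrite (proj2 he N m) by lia; apply C_ext; simpl; ring.
Qed.

Lemma nsq_comb_sub {H : Hilbert} (c : nat -> C) (e : nat -> H) (N M : nat) :
  ons e -> (N <= M)%nat ->
  nsq (hsub (comb c e M) (comb c e N)) =
  rsum (fun n => Csq (c n) * nsq (e n)) M - rsum (fun n => Csq (c n) * nsq (e n)) N.
Proof.
  intros he hNM; induction hNM as [|M hNM IH].
  - replace (hsub (comb c e N) (comb c e N)) with (@hzero H) by hring; rewrite nsq_zero; ring.
  - simpl.
    replace (hsub (hadd (comb c e M) (hscal (c M) (e M))) (comb c e N))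
      with (hadd (hsub (comb c e M) (comb c e N)) (hscal (c M) (e M))) by hring.
    rewrite nsq_add, IH, nsq_scal; autorewrite with ip.
    rewrite !inner_comb_out by (auto; lia); simpl; ring.
Qed.

Lemma nsq_sub_fourier {H : Hilbert} (e : nat -> H) (x : H) (N : nat) : ons e ->
  nsq (hsub x (comb (fun n => inner x (e n)) e N)) =
  nsq x - rsum (fun n => Csq (inner x (e n))) N.
Proof.
  intros he; induction N as [|N IH]; simpl.
  - replace (hsub x hzero) with x by hring; ring.
  - set (y := comb _ e N) in *.
    replace (hsub x (hadd y (hscal (inner x (e N)) (e N))))
      with (hsub (hsub x y) (hscal (inner x (e N)) (e N))) by hring.
    rewrite nsq_sub, IH, nsq_scal; autorewrite with ip.
    unfold y; rewrite inner_comb_out by (auto; lia).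
    destruct (proj1 he N) as [h|h].
    + rewrite h, inner_zeror; unfold Csq; simpl; ring.
    + rewrite h; unfold Csq; simpl; ring.
Qed.

Lemma Bessel {H : Hilbert} (e : nat -> H) (x : H) (N : nat) : ons e ->
  rsum (fun n => Csq (inner x (e n))) N <= nsq x.
Proof.
  intros he; pose proof (nsq_sub_fourier e x N he).
  pose proof (nsq_ge0 (hsub x (comb (fun n => inner x (e n)) e N))); lra.
Qed.

(** By Pythagoras the partial sums are Cauchy once the weighted squares are summable. The weight
    [nsq (e n)] vanishes at padded indices, where the coefficient may be arbitrary. *)
Lemma Riesz_Fischer {H : Hilbert} (c : nat -> C) (e : nat -> H) (M : R) :
  ons e -> (forall N, rsum (fun n => Csq (c n) * nsq (e n)) N <= M) ->
  exists l, hconv (comb c e) l /\ forall n, inner l (e n) = Cmul (c n) (inner (e n) (e n)).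
Proof.
  intros he hM.
  assert (h0 : forall n, 0 <= Csq (c n) * nsq (e n)).
  { intros n; apply Rmult_le_pos; [apply Csq_ge0 | apply nsq_ge0]. }
  destruct (hcomplete H (comb c e)) as [l hl].
  { intros eps heps.
    destruct (rsum_bounded_Cauchy _ M h0 hM (eps * eps) ltac:(nra)) as [N hN].
    assert (hlt : forall m n, (N <= m)%nat -> (m <= n)%nat ->
      hnorm (hsub (comb c e n) (comb c e m)) < eps).
    { intros m n hm hn; apply hnorm_lt_of_nsq; [exact heps|].
      rewrite nsq_comb_sub by assumption; apply hN; assumption. }
    exists N; intros m n hm hn.
    change (hnorm (hsub (comb c e m) (comb c e n)) < eps).
    destruct (PeanoNat.Nat.le_ge_cases m n).
    - rewrite hnorm_sub_sym; auto.
    - auto. }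
  exists l; split; [exact hl|]; intros n.
  transitivity (inner (hscal (c n) (e n)) (e n)); [|apply inner_scall].
  (* The sequence is shifted because the coefficient at [e n] is constant only from the partial sum
     of length [n + 1] on. *)
  apply (inner_lim_eq (fun k => comb c e (n + 1 + k)) (fun _ => hscal (c n) (e n))).
  - intros eps heps; destruct (hl eps heps) as [N hN]; exists N; intros k hk; apply hN; lia.
  - intros eps heps; exists 0%nat; intros k _.
    replace (hsub (hscal (c n) (e n)) (hscal (c n) (e n))) with (@hzero H) by hring.
    rewrite hnorm_zero; exact heps.
  - intros k; rewrite inner_comb_in, inner_scall by (auto; lia); reflexivity.
Qed.

(** In a padded family the factor [inner (e n) (e n)] is 1 or 0, and 0 is harmless when the
    coefficient vanishes there as well. *)
Lemma inner_ons_absorb {H : Hilbert} (e : nat -> H) (n : nat) (a : C) :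
  ons e -> (e n = hzero -> a = C0) -> Cmul a (inner (e n) (e n)) = a.
Proof.
  intros [he _] ha; rewrite inner_self; destruct (he n) as [h|h].
  - rewrite (ha h); apply C_ext; simpl; ring.
  - rewrite h; apply C_ext; simpl; ring.
Qed.

(** The Fourier series of [x] converges to its projection [l] on the closed span of [e], and [T]
    kills [x - l]. This form suits singular vectors, which need not span the kernel of [T]; with [T]
    the identity it gives the usual expansion in a basis. *)
Lemma fourier_image_conv {H : Hilbert} (T : H -> H) (K : R) (e : nat -> H) :
  linear_op T -> bounded_by T K -> ons e ->
  (forall x, (forall n, inner x (e n) = C0) -> T x = hzero) ->
  forall x, hconv (fun N => T (comb (fun n => inner x (e n)) e N)) (T x).
Proof.
  intros hl hb he h0 x.
  destruct (Riesz_Fischer (fun n => inner x (e n)) e (nsq x) he) as [l [hc hi]].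
  { intros N; eapply Rle_trans; [|apply (Bessel e x N he)]; apply rsum_le; intros n _.
    pose proof (ons_nsq_le1 e n he); pose proof (Csq_ge0 (inner x (e n))); nra. }
  replace (T x) with (T l); [apply (hconv_image T K); assumption|].
  apply hsub_eq0; rewrite <- (linear_op_sub T hl); apply h0; intros n.
  rewrite inner_subl, hi, inner_ons_absorb; [apply C_ext; simpl; ring | exact he |].
  intros h; rewrite h; apply inner_zeror.
Qed.

Lemma fourier_conv {H : Hilbert} (e : nat -> H) (x : H) :
  ons e -> complete e -> hconv (comb (fun n => inner x (e n)) e) x.
Proof.
  intros he hc; apply (fourier_image_conv (fun y => y) 1 e); auto.
  - split; reflexivity.
  - split; [lra|]; intros y; lra.
Qed.

Lemma Parseval {H : Hilbert} (e : nat -> H) (x : H) : ons e -> complete e ->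
  forall eps, 0 < eps -> exists N, forall n, (N <= n)%nat ->
  nsq x - eps < rsum (fun k => Csq (inner x (e k))) n.
Proof.
  intros he hc eps heps.
  destruct (fourier_conv e x he hc (sqrt eps) (sqrt_lt_R0 _ heps)) as [N hN].
  exists N; intros n hn; specialize (hN n hn).
  rewrite hnorm_sub_sym in hN; pose proof (nsq_sub_fourier e x n he) as h.
  rewrite <- (hnorm_sqr (hsub _ _)) in h.
  pose proof (hnorm_ge0 (hsub x (comb (fun n => inner x (e n)) e n))).
  pose proof (sqrt_sqrt eps ltac:(lra)); nra.
Qed.

(** * Spectral theorem and adjoints *)

(* Step [n] looks for an admissible vector within 1/2 of the [n]-th point of a dense sequence;
   two orthogonal unit vectors are never that close to a common point, so nothing is missed. *)
Lemma maximal_ons {H : Hilbert} (Q : H -> Prop) : separable H ->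
  exists e : nat -> H, ons e /\ (forall n, e n <> hzero -> Q (e n)) /\
    forall v, nsq v = 1 -> Q v -> ~ (forall n, inner v (e n) = C0).
Proof.
  intros [d hd].
  set (ok := fun (l : list H) (n : nat) (v : H) =>
    nsq v = 1 /\ Q v /\ (forall w, In w l -> inner v w = C0) /\ hnorm (hsub v (d n)) < / 2).
  assert (hpick : forall ln : list H * nat, exists v,
    (ok (fst ln) (snd ln) v) \/ (v = hzero /\ ~ exists w, ok (fst ln) (snd ln) w)).
  { intros [l n]; simpl; destruct (classic (exists w, ok l n w)) as [[w hw]|hn].
    - exists w; left; exact hw.
    - exists hzero; right; split; [reflexivity | exact hn]. }
  apply functional_choice in hpick; destruct hpick as [pick hpick].
  set (pre := fix pre n := match n with
    | O => nil | Datatypes.S n' => pick (pre n', n') :: pre n' end).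
  set (e := fun n => pick (pre n, n)).
  assert (hin : forall m n, (m < n)%nat -> In (e m) (pre n)).
  { intros m n h; induction n as [|n IH]; [lia|]; simpl.
    destruct (PeanoNat.Nat.eq_dec m n) as [->|]; [left; reflexivity | right; apply IH; lia]. }
  assert (he : forall n, ok (pre n) n (e n) \/ (e n = hzero /\ ~ exists w, ok (pre n) n w)).
  { intros n; exact (hpick (pre n, n)). }
  assert (horth : forall m n, (m < n)%nat -> inner (e n) (e m) = C0).
  { intros m n h; destruct (he n) as [[_ [_ [h1 _]]]|[h1 _]].
    - apply h1, hin, h.
    - rewrite h1; apply inner_zerol. }
  exists e; split; [split|split].
  - intros n; destruct (he n) as [[h _]|[h _]]; auto.
  - intros n m h; destruct (PeanoNat.Nat.lt_total n m) as [h1|[h1|h1]]; [|lia|].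
    + apply inner_C0_sym, horth, h1.
    + apply horth, h1.
  - intros n h; destruct (he n) as [[_ [h1 _]]|[h1 _]]; [exact h1 | contradiction].
  - intros v hv1 hvQ hv0; destruct (hd v (/ 2) ltac:(lra)) as [n hn].
    destruct (he n) as [[h1 [_ [_ h2]]]|[_ h1]].
    + assert (h3 : nsq (hsub v (e n)) = 2) by (rewrite nsq_sub, hv0, hv1, h1; simpl; ring).
      rewrite <- hnorm_sqr in h3; rewrite hnorm_sub_sym in h2.
      pose proof (hnorm_sub_triang v (d n) (e n)); pose proof (hnorm_ge0 (hsub v (e n))); nra.
    + apply h1; exists v; split; [exact hv1|split; [exact hvQ|split; [|exact hn]]].
      intros w hw.
      assert (hex : forall k, In w (pre k) -> exists m, w = e m).
      { intros k; induction k as [|k IH]; simpl; [tauto|].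
        intros [<-|h]; [exists k; reflexivity | apply IH, h]. }
      destruct (hex n hw) as [m ->]; apply hv0.
Qed.

Lemma complete_of_maximal {H : Hilbert} (e : nat -> H) :
  (forall v, nsq v = 1 -> ~ (forall n, inner v (e n) = C0)) -> complete e.
Proof.
  intros h x hx; apply NNPP; intros hx0.
  apply (h _ (nsq_normalize x hx0)); intros n.
  rewrite inner_scall, hx; apply C_ext; simpl; ring.
Qed.

Lemma complete_ons_exists {H : Hilbert} : separable H -> exists e : nat -> H, ons e /\ complete e.
Proof.
  intros hs; destruct (maximal_ons (fun _ : H => True) hs) as [e [he [_ hm]]].
  exists e; split; [exact he|]; apply complete_of_maximal; intros v hv; exact (hm v hv I).
Qed.

(* A maximizing sequence for [|Tx|] on the unit sphere of the orthocomplement of [v] is an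
   approximate eigenvector sequence of [T^2] for [m^2]; then [(T - m)(T + m) z = 0]. *)
Lemma eigenvector_exists {H : Hilbert} (T : H -> H) (v : nat -> H) :
  compact_op T -> self_adjoint T ->
  (forall x, (forall n, inner x (v n) = C0) -> forall n, inner (T x) (v n) = C0) ->
  (exists x, (forall n, inner x (v n) = C0) /\ T x <> hzero) ->
  exists (z : H) (lam : R), lam <> 0 /\ nsq z = 1 /\ (forall n, inner z (v n) = C0) /\
    T z = hscal (RtoC lam) z.
Proof.
  intros hcT hsa hinv [x0 [hx0 hTx0]].
  destruct (compact_bounded T hcT) as [K hK].
  destruct hcT as [hl hc].
  set (W := fun x : H => forall n, inner x (v n) = C0) in *.
  assert (hWs : forall a x, W x -> W (hscal a x)).
  { intros a x hx n; rewrite inner_scall, hx; apply C_ext; simpl; ring. }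
  assert (hWa : forall x y, W x -> W y -> W (hadd x y)).
  { intros x y hx hy n; rewrite inner_addl, hx, hy; apply C_ext; simpl; ring. }
  assert (hWl : forall u l, (forall n, W (u n)) -> hconv u l -> W l).
  { intros u l hu hcv n; rewrite <- (inner_zerol (v n)).
    apply (inner_lim_eq u (fun _ => hzero) l); auto.
    - intros eps he; exists 0%nat; intros k _.
      replace (hsub (@hzero H) hzero) with (@hzero H) by hring; rewrite hnorm_zero; exact he.
    - intros k; rewrite inner_zerol; apply hu. }
  destruct (completeness (fun r => exists x, W x /\ nsq x = 1 /\ r = nsq (T x))) as [m2 [hub hlub]].
  { exists (K * K); intros r [x [_ [hx ->]]].
    pose proof (proj2 hK x) as h; rewrite (hnorm_unit x hx) in h.
    rewrite <- hnorm_sqr; pose proof (hnorm_ge0 (T x)); nra. }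
  { assert (hx0' : x0 <> hzero) by (intros ->; apply hTx0, linear_op_zero, hl).
    eexists; exists (hscal (RtoC (/ hnorm x0)) x0); split; [exact (hWs _ _ hx0)|].
    split; [apply nsq_normalize, hx0' | reflexivity]. }
  assert (hle : forall x, W x -> nsq (T x) <= m2 * nsq x).
  { intros x hx; destruct (classic (x = hzero)) as [->|hn].
    - rewrite (linear_op_zero T hl), nsq_zero; lra.
    - pose proof (nsq_pos x hn) as hp.
      assert (hq : nsq (T (hscal (RtoC (/ hnorm x)) x)) <= m2).
      { apply hub; eexists; split; [exact (hWs (RtoC (/ hnorm x)) _ hx)|].
        split; [apply nsq_normalize, hn|reflexivity]. }
      rewrite (proj2 hl), nsq_scal in hq; unfold Csq in hq; simpl in hq.
      replace ((/ hnorm x * / hnorm x + 0 * 0) * nsq (T x)) with (nsq (T x) / nsq x) in hq.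
      + apply (Rmult_le_compat_r (nsq x)) in hq; [|lra].
        unfold Rdiv in hq; rewrite Rmult_assoc, Rinv_l, Rmult_1_r in hq by lra; exact hq.
      + rewrite <- (hnorm_sqr x); field; rewrite <- hnorm_sqr in hp; nra. }
  assert (hm2 : 0 < m2).
  { pose proof (hle x0 hx0) as h; pose proof (nsq_pos _ hTx0); pose proof (nsq_ge0 x0); nra. }
  set (m := sqrt m2).
  assert (hm : m * m = m2) by (apply sqrt_sqrt; lra).
  assert (hmp : 0 < m) by (apply sqrt_lt_R0, hm2).
  assert (hx : forall n : nat, exists x, W x /\ nsq x = 1 /\ m2 - / (INR n + 1) < nsq (T x)).
  { intros n; apply NNPP; intros hn.
    assert (hi : 0 < / (INR n + 1)) by (apply Rinv_0_lt_compat; pose proof (pos_INR n); lra).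
    apply (Rlt_not_le m2 (m2 - / (INR n + 1))); [lra|].
    apply hlub; intros r [x [h1 [h2 ->]]]; apply Rnot_lt_le; intros h3.
    apply hn; exists x; auto. }
  apply functional_choice in hx; destruct hx as [x hx].
  destruct (hc x) as [phi [y [hphi hy]]].
  { exists 1; intros n; rewrite hnorm_unit by apply hx; lra. }
  assert (hTT : hconv (fun n => T (T (x (phi n)))) (T y)) by (apply (hconv_image T K); assumption).
  (* For a unit vector [x] of [W], [|m2 x - T T x|^2 = m2^2 - 2 m2 |T x|^2 + |T T x|^2]. As [T x] is
     again in [W], the last term is at most [m2 |T x|^2], so the whole is at most
     [m2 (m2 - |T x|^2)], which is below [m2 / (phi n + 1)] along the subsequence. *)
  assert (happ : hconv (fun n => hsub (hscal (RtoC m2) (x (phi n))) (T (T (x (phi n))))) hzero).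
  { intros eps he.
    destruct (INR_unbounded (m2 / (eps * eps))) as [N hN].
    exists N; intros n hn.
    replace (hsub (hsub (hscal (RtoC m2) (x (phi n))) (T (T (x (phi n))))) hzero)
      with (hsub (hscal (RtoC m2) (x (phi n))) (T (T (x (phi n))))) by hring.
    apply hnorm_lt_of_nsq; [exact he|].
    destruct (hx (phi n)) as [h1 [h2 h3]].
    rewrite nsq_sub, nsq_scal, inner_scall, <- hsa, inner_self, h2.
    pose proof (hle (T (x (phi n))) (hinv _ h1)) as h4.
    unfold Csq; simpl.
    assert (h5 : INR N <= INR (phi n)).
    { apply le_INR; pose proof (strictly_increasing_ge phi hphi n); lia. }
    assert (h6 : m2 * / (INR (phi n) + 1) < eps * eps).
    { assert (0 < eps * eps) by nra.
      apply (Rmult_lt_reg_r (INR (phi n) + 1)); [pose proof (pos_INR (phi n)); lra|].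
      rewrite Rmult_assoc, Rinv_l by (pose proof (pos_INR (phi n)); lra).
      assert (h7 : m2 / (eps * eps) < INR (phi n) + 1) by lra.
      apply (Rmult_lt_compat_r (eps * eps)) in h7; [|assumption].
      unfold Rdiv in h7; rewrite Rmult_assoc, Rinv_l in h7 by lra; lra. }
    nra. }
  (* Since [T (T x)] converges along the subsequence and [m2 x] is asymptotic to it, the vectors
     themselves converge in norm, so their limit [z] is again a unit vector of [W]. *)
  pose proof (hconv_of_asymptotic _ _ _ hTT happ) as hmx.
  apply (hconv_scal (RtoC (/ m2))) in hmx.
  apply (hconv_ext _ (fun n => x (phi n))) in hmx.
  2: { intros n; rewrite <- hscal_mul; replace (Cmul (RtoC (/ m2)) (RtoC m2)) with C1.
       - apply hscal_one.
       - apply C_ext; simpl; field; lra. }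
  set (z := hscal (RtoC (/ m2)) (T y)) in *.
  assert (hz1 : hnorm z = 1).
  { apply NNPP; intros hn.
    destruct (hnorm_lim _ _ hmx (Rabs (1 - hnorm z))) as [N hN].
    - apply Rabs_pos_lt; lra.
    - specialize (hN N (le_n N)); rewrite hnorm_unit in hN by apply hx; lra. }
  assert (hzW : W z) by (apply (hWl _ _ (fun n => proj1 (hx (phi n))) hmx)).
  assert (hzT : T (T z) = hscal (RtoC m2) z).
  { assert (hTz : T z = y).
    { apply (hconv_unique (fun n => T (x (phi n)))); [|exact hy].
      apply (hconv_image T K); assumption. }
    rewrite hTz; unfold z; rewrite <- hscal_mul.
    replace (Cmul (RtoC m2) (RtoC (/ m2))) with C1 by (apply C_ext; simpl; field; lra).
    symmetry; apply hscal_one. }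
  destruct (classic (hadd (T z) (hscal (RtoC m) z) = hzero)) as [h0|h0].
  - exists z, (- m); split; [lra|]; split; [rewrite <- hnorm_sqr, hz1; ring|].
    split; [exact hzW|].
    replace (T z) with (hsub (hadd (T z) (hscal (RtoC m) z)) (hscal (RtoC m) z)) by hring.
    rewrite h0; hring.
  - set (w := hadd (T z) (hscal (RtoC m) z)) in *.
    assert (hw : T w = hscal (RtoC m) w).
    { unfold w; rewrite (proj1 hl), (proj2 hl), hzT, <- hm; hring. }
    exists (hscal (RtoC (/ hnorm w)) w), m; split; [lra|].
    split; [apply nsq_normalize, h0|]; split.
    + exact (hWs _ _ (hWa _ _ (hinv _ hzW) (hWs _ _ hzW))).
    + rewrite (proj2 hl), hw; hring.
Qed.

(** Let [g] be a maximal orthonormal system of eigenvectors. A nonzero [x] orthogonal to [g] is an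
    eigenvector for 0 if [T x = 0]; otherwise [T] has an eigenvector in the invariant
    orthocomplement of [g]. Both contradict maximality. *)
Lemma eigenbasis_exists {H : Hilbert} (T : H -> H) :
  separable H -> compact_op T -> self_adjoint T ->
  exists (g : nat -> H) (al : nat -> R), ons g /\ complete g /\
    forall n, T (g n) = hscal (RtoC (al n)) (g n).
Proof.
  intros hs hc hsa.
  destruct (maximal_ons (fun v => exists lam : R, T v = hscal (RtoC lam) v) hs)
    as [g [hg [hQ hm]]].
  assert (hal : forall n, exists lam, T (g n) = hscal (RtoC lam) (g n)).
  { intros n; destruct (classic (g n = hzero)) as [h|h]; [|apply hQ, h].
    exists 0; rewrite h, (linear_op_zero T (proj1 hc)), hscal_zero; reflexivity. }
  apply functional_choice in hal; destruct hal as [al hal].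
  exists g, al; split; [exact hg|]; split; [|exact hal].
  intros x hx; apply NNPP; intros hx0.
  destruct (classic (T x = hzero)) as [h0|h0].
  - apply (hm _ (nsq_normalize x hx0)).
    + exists 0; rewrite (proj2 (proj1 hc)), h0; hring.
    + intros n; rewrite inner_scall, hx; apply C_ext; simpl; ring.
  - destruct (eigenvector_exists T g hc hsa) as [z [lam [_ [hz1 [hz0 hz]]]]].
    + intros y hy n; rewrite hsa, hal, inner_scalr, hy; apply C_ext; simpl; ring.
    + exists x; auto.
    + apply (hm z hz1); [exists lam; exact hz | exact hz0].
Qed.

(** * Adjoints and permanence of compactness *)

Lemma adjoint_linear {H : Hilbert} (T A : H -> H) : adjoint_of T A -> linear_op A.
Proof.
  intros h.
  assert (h' : forall x y, inner (A x) y = inner x (T y)).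
  { intros x y; rewrite (inner_conj H y (A x)), <- h, (inner_conj H x (T y)).
    apply C_ext; simpl; ring. }
  split; intros; apply inner_ext; intros z; rewrite h'; autorewrite with ip; rewrite ?h';
    reflexivity.
Qed.

Lemma adjoint_of_sym {H : Hilbert} (T A : H -> H) : adjoint_of T A -> adjoint_of A T.
Proof.
  intros h x y; rewrite (inner_conj H y (A x)), <- h, (inner_conj H x (T y)).
  apply C_ext; simpl; ring.
Qed.

(** Riesz representation in coordinates: the vector [z] representing [x -> <T x, y>] must have the
    Fourier coefficients [<y, T e_n>], and Riesz-Fischer produces it once they are square
    summable. *)
Lemma adjoint_exists {H : Hilbert} (T : H -> H) (K : R) :
  separable H -> linear_op T -> bounded_by T K -> exists A, adjoint_of T A.
Proof.
  intros hs hl [hK hb]; destruct (complete_ons_exists hs) as [e [he hcm]].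
  assert (hA : forall y, exists z, forall x, inner (T x) y = inner x z).
  { intros y.
    set (c := fun n => inner y (T (e n))).
    assert (hT : forall N, inner (T (comb c e N)) y = RtoC (rsum (fun n => Csq (c n)) N)).
    { induction N as [|N IH]; simpl.
      - rewrite (linear_op_zero T hl); apply inner_zerol.
      - rewrite (proj1 hl), (proj2 hl); autorewrite with ip; rewrite IH.
        rewrite (inner_conj H y (T (e N))); unfold c, Csq; apply C_ext; simpl; ring. }
    assert (hc0 : forall n, Csq (c n) * nsq (e n) = Csq (c n)).
    { intros n; destruct (proj1 he n) as [h|h]; rewrite h; [|ring].
      unfold c; rewrite h, (linear_op_zero T hl), inner_zeror; unfold Csq; simpl; ring. }
    (* The functional is tested on its own partial sum [v = comb c e N]: both [<T v, y>] and [|v|^2]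
       equal the sum [s] of the first [N] squares, so Cauchy-Schwarz gives [s^2 <= K^2 |y|^2 s]. *)
    destruct (Riesz_Fischer c e (K * K * nsq y) he) as [z [_ hz]].
    { intros N; rewrite (rsum_ext _ (fun n => Csq (c n))) by (intros; apply hc0).
      set (s := rsum (fun n => Csq (c n)) N).
      assert (hs0 : 0 <= s) by (apply rsum_ge0; intros; apply Csq_ge0).
      assert (hn : nsq (comb c e N) = s).
      { pose proof (nsq_comb_sub c e 0 N he ltac:(lia)) as h; simpl in h.
        replace (hsub (comb c e N) hzero) with (comb c e N) in h by hring.
        rewrite h; unfold s; rewrite Rminus_0_r; apply rsum_ext; intros; apply hc0. }
      pose proof (Cauchy_Schwarz_sqr (T (comb c e N)) y) as h1.
      rewrite hT in h1; unfold Csq in h1; simpl in h1.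
      change (rsum (fun n => Re (c n) * Re (c n) + Im (c n) * Im (c n)) N) with s in h1.
      assert (h2 : nsq (T (comb c e N)) <= K * K * s).
      { rewrite <- hn, <- !hnorm_sqr; pose proof (hb (comb c e N)).
        pose proof (hnorm_ge0 (comb c e N)); pose proof (hnorm_ge0 (T (comb c e N))); nra. }
      pose proof (nsq_ge0 y) as hy.
      assert (h3 : s * s <= (K * K * nsq y) * s) by nra.
      destruct hs0 as [hs0|hs0]; [nra|].
      rewrite <- hs0; nra. }
    exists z; intros x.
    apply (inner_lim_eq (fun N => T (comb (fun n => inner x (e n)) e N))
      (comb (fun n => inner x (e n)) e)).
    - apply (hconv_image T K); [exact hl | split; assumption | apply fourier_conv; assumption].
    - apply fourier_conv; assumption.
    - intros N; induction N as [|N IH]; simpl.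
      + rewrite (linear_op_zero T hl), !inner_zerol; reflexivity.
      + rewrite (proj1 hl), (proj2 hl); autorewrite with ip; rewrite IH; f_equal; f_equal.
        rewrite (inner_conj H z (e N)), hz, inner_ons_absorb; [|exact he|].
        * unfold c; apply inner_conj.
        * intros h; unfold c; rewrite h, (linear_op_zero T hl); apply inner_zeror. }
  apply functional_choice in hA; destruct hA as [A hA]; exists A; intros x y; apply hA.
Qed.

Lemma adjoint_bounded {H : Hilbert} (T A : H -> H) (K : R) :
  adjoint_of T A -> bounded_by T K -> bounded_by A K.
Proof.
  intros hA [hK hT]; split; [exact hK|]; intros x.
  pose proof (Cauchy_Schwarz (T (A x)) x) as h; rewrite hA, inner_self, Cmod_RtoC in h.
  rewrite Rabs_pos_eq in h by apply nsq_ge0; rewrite <- hnorm_sqr in h.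
  pose proof (hT (A x)); pose proof (hnorm_ge0 x); destruct (hnorm_ge0 (A x)) as [h0|h0]; nra.
Qed.

(** If the images under [T] of a bounded sequence are Cauchy, the domination applied to differences
    makes the images under [A] Cauchy too. The mixed product on the right covers both adjoints and
    moduli. *)
Lemma compact_of_dominated {H : Hilbert} (T A : H -> H) (K : R) :
  compact_op T -> linear_op A ->
  (forall x, nsq (A x) <= hnorm (T x) * (K * hnorm x)) -> compact_op A.
Proof.
  intros [hl hc] hA hd; split; [exact hA|]; intros x [B hB].
  destruct (hc x (ex_intro _ B hB)) as [phi [y [hphi hy]]].
  exists phi.
  destruct (hcomplete H (fun n => A (x (phi n)))) as [l hl'].
  - intros eps he.
    assert (hB0 : 0 <= B) by (pose proof (hB 0%nat); pose proof (hnorm_ge0 (x 0%nat)); lra).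
    (* [L] bounds [K * hnorm d] for differences [d] of norm at most [2 * B]; adding 1 makes it a
       safe divisor. *)
    set (L := Rabs K * (2 * B) + 1).
    assert (hL : 0 < L) by (unfold L; pose proof (Rabs_pos K); nra).
    assert (hq : 0 < eps * eps / (2 * L)) by (apply Rdiv_lt_0_compat; nra).
    destruct (hy _ hq) as [N hN]; exists N; intros m n hm hn.
    change (hnorm (hsub (A (x (phi m))) (A (x (phi n)))) < eps).
    apply hnorm_lt_of_nsq; [exact he|].
    rewrite <- (linear_op_sub A hA).
    set (d := hsub (x (phi m)) (x (phi n))).
    assert (hd1 : hnorm d <= 2 * B).
    { pose proof (hnorm_sub_triang (x (phi m)) hzero (x (phi n))) as h.
      rewrite (hnorm_sub_sym hzero) in h.
      replace (hsub (x (phi m)) hzero) with (x (phi m)) in h by hring.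
      replace (hsub (x (phi n)) hzero) with (x (phi n)) in h by hring.
      pose proof (hB (phi m)); pose proof (hB (phi n)); unfold d; lra. }
    assert (hd2 : hnorm (T d) < 2 * (eps * eps / (2 * L))).
    { unfold d; rewrite (linear_op_sub T hl).
      pose proof (hnorm_sub_triang (T (x (phi m))) y (T (x (phi n)))) as h.
      rewrite (hnorm_sub_sym y) in h.
      pose proof (hN m hm); pose proof (hN n hn); simpl in *; lra. }
    assert (hd3 : K * hnorm d <= L).
    { unfold L; pose proof (Rle_abs K); pose proof (Rabs_pos K); pose proof (hnorm_ge0 d); nra. }
    pose proof (hd d) as h; pose proof (hnorm_ge0 (T d)).
    apply Rle_lt_trans with (hnorm (T d) * L); [nra|].
    replace (eps * eps) with (2 * (eps * eps / (2 * L)) * L) by (field; lra).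
    apply Rmult_lt_compat_r; assumption.
  - exists l; split; [exact hphi | exact hl'].
Qed.

Lemma compact_comp_l {H : Hilbert} (A T : H -> H) (K : R) :
  linear_op A -> bounded_by A K -> compact_op T -> compact_op (fun x => A (T x)).
Proof.
  intros hl hb [hT hc]; split.
  - split; intros; [rewrite (proj1 hT), (proj1 hl) | rewrite (proj2 hT), (proj2 hl)]; reflexivity.
  - intros x hx; destruct (hc x hx) as [phi [y [hphi hy]]].
    exists phi, (A y); split; [exact hphi|]; apply (hconv_image A K); assumption.
Qed.

Lemma compact_comp_r {H : Hilbert} (T A : H -> H) (K : R) :
  linear_op A -> bounded_by A K -> compact_op T -> compact_op (fun x => T (A x)).
Proof.
  intros hl [hK hb] [hT hc]; split.
  - split; intros; [rewrite (proj1 hl), (proj1 hT) | rewrite (proj2 hl), (proj2 hT)]; reflexivity.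
  - intros x [B hB]; apply (hc (fun n => A (x n))); exists (K * B); intros n.
    pose proof (hb (x n)); pose proof (hB n); nra.
Qed.

(** Since [|A x|^2 = <T (A x), x>], the adjoint is dominated by the compact operator [T A]. *)
Lemma adjoint_compact {H : Hilbert} (T A : H -> H) :
  compact_op T -> adjoint_of T A -> compact_op A.
Proof.
  intros hc hA; destruct (compact_bounded T hc) as [K hK].
  pose proof (adjoint_linear T A hA) as hl.
  apply (compact_of_dominated (fun x => T (A x)) A 1); [|exact hl|].
  - apply (compact_comp_r T A K); [exact hl | apply (adjoint_bounded T); assumption | exact hc].
  - intros x; pose proof (Cauchy_Schwarz (T (A x)) x) as h; rewrite hA, inner_self, Cmod_RtoC in h.
    rewrite Rabs_pos_eq in h by apply nsq_ge0; lra.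
Qed.

Lemma compact_of_same_norm {H : Hilbert} (T P : H -> H) :
  compact_op T -> linear_op P -> (forall x, nsq (P x) = nsq (T x)) -> compact_op P.
Proof.
  intros hc hP h; destruct (compact_bounded T hc) as [K hK].
  apply (compact_of_dominated T P K hc hP); intros x; rewrite h, <- hnorm_sqr.
  apply Rmult_le_compat_l; [apply hnorm_ge0 | apply hK].
Qed.

Lemma compact_add {H : Hilbert} (T A : H -> H) :
  compact_op T -> compact_op A -> compact_op (fun x => hadd (T x) (A x)).
Proof.
  intros [hT hTc] [hA hAc]; split.
  - split; intros; [rewrite (proj1 hT), (proj1 hA) | rewrite (proj2 hT), (proj2 hA)]; hring.
  - intros x [B hB].
    destruct (hTc x (ex_intro _ B hB)) as [phi [y [hphi hy]]].
    destruct (hAc (fun n => x (phi n))) as [psi [y' [hpsi hy']]]; [exists B; auto|].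
    exists (fun n => phi (psi n)), (hadd y y'); split.
    + intros n; apply strictly_increasing_lt; [exact hphi | apply hpsi].
    + intros eps he.
      destruct (hy (eps / 2) ltac:(lra)) as [N1 h1], (hy' (eps / 2) ltac:(lra)) as [N2 h2].
      exists (max N1 N2); intros n hn.
      specialize (h2 n ltac:(lia)).
      pose proof (strictly_increasing_ge psi hpsi n); specialize (h1 (psi n) ltac:(lia)).
      simpl in *.
      replace (hsub (hadd (T (x (phi (psi n)))) (A (x (phi (psi n))))) (hadd y y'))
        with (hadd (hsub (T (x (phi (psi n)))) y) (hsub (A (x (phi (psi n)))) y')) by hring.
      pose proof (hnorm_triang (hsub (T (x (phi (psi n)))) y) (hsub (A (x (phi (psi n)))) y')); lra.
Qed.

Lemma compact_scal {H : Hilbert} (a : C) (T : H -> H) :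
  compact_op T -> compact_op (fun x => hscal a (T x)).
Proof.
  intros hc; apply (compact_comp_l (fun x => hscal a x) T (Cmod a)); [| |exact hc].
  - split; intros; hring.
  - split; [apply Cmod_ge0|]; intros x; rewrite hnorm_scal; lra.
Qed.

(** * The Jensen-type inequality *)

Lemma rpow_ge0 (x p : R) : 0 <= rpow x p.
Proof. unfold rpow; destruct Rle_dec; [lra | left; apply exp_pos]. Qed.

Lemma rpow_0 (p : R) : rpow 0 p = 0.
Proof. unfold rpow; destruct Rle_dec; lra. Qed.

Lemma rpow_pos (x p : R) : 0 < x -> rpow x p = Rpower x p.
Proof. intros h; unfold rpow; destruct Rle_dec; [lra | reflexivity]. Qed.

Lemma rpow_mono (x y p : R) : 0 <= p -> x <= y -> rpow x p <= rpow y p.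
Proof.
  intros hp h; destruct (Rle_lt_dec x 0) as [hx|hx].
  - unfold rpow at 1; destruct Rle_dec; [apply rpow_ge0 | lra].
  - rewrite !rpow_pos by lra; apply Rle_Rpower_l; lra.
Qed.

Lemma rpow_mul (x y p : R) : 0 <= x -> 0 <= y -> rpow (x * y) p = rpow x p * rpow y p.
Proof.
  intros [hx|<-] [hy|<-]; rewrite ?Rmult_0_l, ?Rmult_0_r, ?rpow_0; try ring.
  rewrite !rpow_pos by nra; symmetry; apply Rpower_mult_distr; assumption.
Qed.

(** The sum is at most twice the larger of [a] and [b]. *)
Lemma rpow_add_le (a b p : R) : 0 <= p -> 0 <= a -> 0 <= b ->
  rpow (a + b) p <= rpow 2 p * (rpow a p + rpow b p).
Proof.
  intros hp ha hb.
  pose proof (rpow_ge0 a p); pose proof (rpow_ge0 b p); pose proof (rpow_ge0 2 p).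
  destruct (Rle_lt_dec a b) as [h|h].
  - apply Rle_trans with (rpow (2 * b) p); [apply rpow_mono; lra|].
    rewrite rpow_mul by lra; nra.
  - apply Rle_trans with (rpow (2 * a) p); [apply rpow_mono; lra|].
    rewrite rpow_mul by lra; nra.
Qed.

(** With [u = exp m], the bound [exp t >= 1 + t] is used twice: [u^p >= u (1 + (p - 1) m)] from
    [t = (p - 1) m], and [u m >= u - 1] from [t = - m]. *)
Lemma Rpower_Bernoulli (p u : R) : 1 <= p -> 0 < u -> 1 + p * (u - 1) <= Rpower u p.
Proof.
  intros hp hu; unfold Rpower.
  set (m := ln u); assert (hm : u = exp m) by (symmetry; apply exp_ln, hu).
  pose proof (exp_ineq1_le (p * m - m)) as h1; pose proof (exp_ineq1_le (- m)) as h2.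
  pose proof (exp_pos m) as h3.
  apply (Rmult_le_compat_l (exp m)) in h1; [|lra]; rewrite <- exp_plus in h1.
  replace (m + (p * m - m)) with (p * m) in h1 by ring.
  apply (Rmult_le_compat_l (exp m)) in h2; [|lra]; rewrite <- exp_plus, Rplus_opp_r, exp_0 in h2.
  apply (Rmult_le_compat_l (p - 1)) in h2; [|lra].
  rewrite hm; nra.
Qed.

(** The graph of the convex function [x^p] lies above its tangent at [t]; [p * (rpow t p / t)] is
    the slope [p t^(p-1)]. Homogeneity reduces this to Bernoulli at [s / t], with [s = 0] apart. *)
Lemma rpow_tangent (p t s : R) : 1 <= p -> 0 < t -> 0 <= s ->
  rpow t p + p * (rpow t p / t) * (s - t) <= rpow s p.
Proof.
  intros hp ht hs; pose proof (rpow_ge0 t p) as h0.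
  replace s with (t * (s / t)) by (field; lra).
  destruct hs as [hs|<-].
  - assert (hu : 0 < s / t) by (apply Rdiv_lt_0_compat; lra).
    rewrite (rpow_mul t) by lra; rewrite (rpow_pos (s / t)) by exact hu.
    pose proof (Rpower_Bernoulli p (s / t) hp hu) as h.
    apply (Rmult_le_compat_l (rpow t p)) in h; [|exact h0].
    replace (p * (rpow t p / t) * (t * (s / t) - t)) with (rpow t p * (p * (s / t - 1)))
      by (field; lra); lra.
  - replace (t * (0 / t)) with 0 by (field; lra); rewrite rpow_0.
    replace (p * (rpow t p / t) * (0 - t)) with (- p * rpow t p) by (field; lra); nra.
Qed.

(** Jensen's inequality before the tangent point is specialized to the mean: [a] may differ from the
    weighted sum, so a limit can be taken later. Weights of total mass below 1 are allowed because
    the tangent has the nonpositive intercept [(1 - p) * rpow a p]. *)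
Lemma rpow_weighted_tangent (p a : R) (s w : nat -> R) (K : nat) :
  1 <= p -> 0 < a -> (forall k, 0 <= s k) -> (forall k, 0 <= w k) -> rsum w K <= 1 ->
  rpow a p + p * (rpow a p / a) * (rsum (fun k => s k * w k) K - a)
    <= rsum (fun k => rpow (s k) p * w k) K.
Proof.
  intros hp ha hs hw hW.
  apply Rle_trans with
    (rsum (fun k => (rpow a p + p * (rpow a p / a) * (s k - a)) * w k) K).
  - rewrite (rsum_ext (fun k => (rpow a p + p * (rpow a p / a) * (s k - a)) * w k)
      (fun k => (1 - p) * rpow a p * w k + p * (rpow a p / a) * (s k * w k)))
      by (intros; cbv beta; field; lra).
    rewrite rsum_plus, !rsum_scal.
    replace (p * (rpow a p / a) * (rsum (fun k => s k * w k) K - a)) with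
      (p * (rpow a p / a) * rsum (fun k => s k * w k) K - p * rpow a p) by (field; lra).
    assert (0 <= rpow a p) by apply rpow_ge0.
    assert (0 <= (p - 1) * rpow a p) by (apply Rmult_le_pos; lra).
    pose proof (rsum_ge0 w K hw); nra.
  - apply rsum_le; intros k _; apply Rmult_le_compat_r; [apply hw|].
    apply rpow_tangent; auto.
Qed.

(* Jensen's inequality for the doubly substochastic weights [w]; [a n] is only bounded by the
   infinite sum of [s k * w n k], whence the [eps]. *)
Lemma doubly_substochastic_rpow (p M : R) (a s : nat -> R) (w : nat -> nat -> R) :
  1 <= p -> (forall n, 0 <= a n) -> (forall k, 0 <= s k) -> (forall n k, 0 <= w n k) ->
  (forall n K, rsum (w n) K <= 1) -> (forall k N, rsum (fun n => w n k) N <= 1) ->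
  (forall n eps, 0 < eps -> exists K0, forall K, (K0 <= K)%nat ->
     a n <= rsum (fun k => s k * w n k) K + eps) ->
  (forall K, rsum (fun k => rpow (s k) p) K <= M) ->
  forall N, rsum (fun n => rpow (a n) p) N <= M.
Proof.
  intros hp ha hs hw hrow hcol happ hM N.
  assert (h1 : forall n eps, 0 < eps -> exists K0, forall K, (K0 <= K)%nat ->
    rpow (a n) p <= rsum (fun k => rpow (s k) p * w n k) K + eps).
  { intros n eps he; destruct (ha n) as [han|han].
    (* [c] is the slope of the tangent at [a n]: an error [eps / c] in the weighted sum costs
       exactly [eps] in the tangent bound. *)
    - set (c := p * (rpow (a n) p / a n)).
      assert (hc : 0 < c).
      { unfold c; rewrite rpow_pos by exact han; apply Rmult_lt_0_compat; [lra|].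
        apply Rdiv_lt_0_compat; [apply exp_pos | exact han]. }
      destruct (happ n (eps / c)) as [K0 hK0]; [apply Rdiv_lt_0_compat; assumption|].
      exists K0; intros K hK; specialize (hK0 K hK).
      pose proof (rpow_weighted_tangent p (a n) s (w n) K hp han hs (hw n) (hrow n K)) as h.
      fold c in h.
      assert (h2 : - (eps / c) <= rsum (fun k => s k * w n k) K - a n) by lra.
      apply (Rmult_le_compat_l c) in h2; [|lra].
      replace (c * - (eps / c)) with (- eps) in h2 by (field; lra); lra.
    - exists 0%nat; intros K _; rewrite <- han, rpow_0.
      assert (0 <= rsum (fun k => rpow (s k) p * w n k) K); [|lra].
      apply rsum_ge0; intros k; apply Rmult_le_pos; [apply rpow_ge0 | apply hw]. }
  (* For fixed [N] one truncation [K] serves all rows, so only a finite double sum has to be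
     exchanged. *)
  assert (h2 : forall eps, 0 < eps -> exists K0, forall K, (K0 <= K)%nat ->
    rsum (fun n => rpow (a n) p) N
      <= rsum (fun n => rsum (fun k => rpow (s k) p * w n k) K) N + eps).
  { induction N as [|N IH]; intros eps he; simpl.
    - exists 0%nat; intros; lra.
    - destruct (IH (eps / 2) ltac:(lra)) as [K1 hK1], (h1 N (eps / 2) ltac:(lra)) as [K2 hK2].
      exists (max K1 K2); intros K hK.
      specialize (hK1 K ltac:(lia)); specialize (hK2 K ltac:(lia)); lra. }
  apply Rnot_lt_le; intros hlt.
  destruct (h2 ((rsum (fun n => rpow (a n) p) N - M) / 2) ltac:(lra)) as [K hK].
  specialize (hK K (le_n K)).
  rewrite rsum_exchange in hK.
  assert (h3 : rsum (fun k => rsum (fun n => rpow (s k) p * w n k) N) K <= M).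
  { eapply Rle_trans; [|apply (hM K)]; apply rsum_le; intros k _.
    rewrite rsum_scal; pose proof (hcol k N); pose proof (rpow_ge0 (s k) p); nra. }
  lra.
Qed.

(** * Singular value decompositions and Bessel systems *)

(** Zero values of [s] are allowed, so the definition fits both a padded list of positive singular
    values and a full eigenbasis that includes kernel vectors. *)
Definition svd {H : Hilbert} (T : H -> H) (s : nat -> R) (e sg : nat -> H) : Prop :=
  ons e /\ ons sg /\ (forall k, 0 <= s k) /\ (forall k, T (e k) = hscal (RtoC (s k)) (sg k)) /\
  (forall x, (forall n, inner x (e n) = C0) -> T x = hzero).

(** The property shared by orthonormal systems and by frames with upper bound at most 1. *)
Definition contractive_Bessel {H : Hilbert} (f : nat -> H) : Prop :=
  forall x N, rsum (fun n => Csq (inner x (f n))) N <= nsq x.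

(** For [x = f n] the Bessel sum contains the term [|f_n|^4], so [|f_n|^4 <= |f_n|^2]. *)
Lemma contractive_Bessel_nsq_le1 {H : Hilbert} (f : nat -> H) (n : nat) :
  contractive_Bessel f -> nsq (f n) <= 1.
Proof.
  intros hf; pose proof (hf (f n) (Datatypes.S n)) as h.
  pose proof (rsum_term_le (fun k => Csq (inner (f n) (f k))) (Datatypes.S n) n
    (fun k => Csq_ge0 _) ltac:(lia)) as h1; cbv beta in h1.
  rewrite inner_self in h1; unfold Csq in h1 at 1; simpl Re in h1; simpl Im in h1.
  pose proof (nsq_ge0 (f n)); nra.
Qed.

Lemma svd_rpow_bound {H : Hilbert} (T : H -> H) (K p M : R) (s : nat -> R) (e sg f g : nat -> H) :
  1 <= p -> linear_op T -> bounded_by T K -> svd T s e sg ->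
  contractive_Bessel f -> contractive_Bessel g ->
  (forall N, rsum (fun k => rpow (s k) p) N <= M) ->
  forall N, rsum (fun n => rpow (Cmod (inner (T (f n)) (g n))) p) N <= M.
Proof.
  intros hp hl hb [he [hsg [hs [hTe h0]]]] hf hg hM.
  set (w := fun n k => (Csq (inner (f n) (e k)) + Csq (inner (g n) (sg k))) / 2).
  apply (doubly_substochastic_rpow p M _ s w); auto.
  - intros n; apply Cmod_ge0.
  - intros n k; unfold w; pose proof (Csq_ge0 (inner (f n) (e k)));
      pose proof (Csq_ge0 (inner (g n) (sg k))); lra.
  (* Row sums use Bessel for [e] and [sg] together with [|f_n|, |g_n| <= 1]; the column sums below
     use the Bessel bounds of [f] and [g] together with [|e_k|, |sg_k| <= 1]. *)
  - intros n L; unfold w.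
    rewrite (rsum_ext _ (fun k => / 2 * (Csq (inner (f n) (e k)) + Csq (inner (g n) (sg k)))))
      by (intros; cbv beta; field).
    rewrite rsum_scal, rsum_plus.
    pose proof (Bessel e (f n) L he); pose proof (Bessel sg (g n) L hsg).
    pose proof (contractive_Bessel_nsq_le1 f n hf); pose proof (contractive_Bessel_nsq_le1 g n hg).
    lra.
  - intros k N; unfold w.
    rewrite (rsum_ext _ (fun n => / 2 * (Csq (inner (e k) (f n)) + Csq (inner (sg k) (g n)))))
      by (intros; cbv beta; rewrite (Csq_inner_sym (e k)), (Csq_inner_sym (sg k)); field).
    rewrite rsum_scal, rsum_plus.
    pose proof (hf (e k) N); pose proof (hg (sg k) N).
    pose proof (ons_nsq_le1 e k he); pose proof (ons_nsq_le1 sg k hsg); lra.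
  - intros n eps heps.
    pose proof (fourier_image_conv T K e hl hb he h0 (f n)) as hc.
    destruct (inner_approx _ _ (g n) hc eps heps) as [K0 hK0].
    exists K0; intros L hL; specialize (hK0 L hL); simpl in hK0.
    set (y := fun L => T (comb (fun k => inner (f n) (e k)) e L)) in *.
    (* The [k]-th term of the expansion is [s_k <f_n, e_k> <sg_k, g_n>], and the product of the two
       moduli is at most the mean of their squares. *)
    assert (hy : forall L, Cmod (inner (y L) (g n)) <= rsum (fun k => s k * w n k) L).
    { induction L0 as [|L0 IH]; unfold y in *; simpl.
      - rewrite (linear_op_zero T hl), inner_zerol, Cmod_C0; lra.
      - rewrite (proj1 hl), (proj2 hl), hTe; autorewrite with ip.
        eapply Rle_trans; [apply Cmod_triang|]; apply Rplus_le_compat; [exact IH|].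
        rewrite !Cmod_mul, Cmod_RtoC, Rabs_pos_eq by apply hs.
        rewrite (inner_conj H (g n) (sg L0)), Cmod_conj.
        unfold w; rewrite <- !Cmod_sqr.
        set (a := Cmod (inner (f n) (e L0))); set (b := Cmod (inner (g n) (sg L0))).
        replace (a * (s L0 * b)) with (s L0 * (a * b)) by ring.
        apply Rmult_le_compat_l; [apply hs|].
        pose proof (Rle_0_sqr (a - b)) as h; unfold Rsqr in h; lra. }
    specialize (hy L).
    replace (inner (T (f n)) (g n)) with (Cadd (inner (y L) (g n)) (Cmul (RtoC (-1))
      (Cadd (inner (y L) (g n)) (Cmul (RtoC (-1)) (inner (T (f n)) (g n))))))
      by (apply C_ext; simpl; ring).
    eapply Rle_trans; [apply Cmod_triang|].
    rewrite (Cmod_mul (RtoC (-1))), Cmod_RtoC, Rabs_left by lra.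
    unfold y in *; lra.
Qed.

Lemma ons_contractive_Bessel {H : Hilbert} (e : nat -> H) : ons e -> contractive_Bessel e.
Proof. intros he x N; apply Bessel, he. Qed.

(** * Singular values *)

(** Infinitely many orthonormal eigenvectors for [lam] would have images at mutual distance
    [sqrt 2 * |lam|], while terms of a convergent subsequence come closer than [|lam|]. *)
Lemma eigenvalue_finite_multiplicity {H : Hilbert} (P : H -> H) (e : nat -> H) (lam : R)
    (Q : nat -> Prop) :
  compact_op P -> ons e -> lam <> 0 ->
  (forall n, Q n -> e n <> hzero /\ P (e n) = hscal (RtoC lam) (e n)) ->
  exists l, NoDup l /\ forall n, In n l <-> Q n.
Proof.
  intros [hl hc] he hlam hQ.
  assert (hN : exists N, forall n, Q n -> (n < N)%nat).
  { apply NNPP; intros hn.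
    assert (hg : forall N : nat, exists n, (N <= n)%nat /\ Q n).
    { intros N; apply NNPP; intros h; apply hn; exists N; intros n hq.
      apply PeanoNat.Nat.nle_gt; intros h1; apply h; exists n; auto. }
    apply functional_choice in hg; destruct hg as [g hg].
    set (phi := fix phi n := match n with
      | O => g O | Datatypes.S n' => g (Datatypes.S (phi n')) end).
    assert (hphi : forall n, (phi n < phi (Datatypes.S n))%nat).
    { intros n; simpl; pose proof (proj1 (hg (Datatypes.S (phi n)))); lia. }
    assert (hphiQ : forall n, Q (phi n)) by (intros [|n]; apply hg).
    assert (hunit : forall n, nsq (e (phi n)) = 1).
    { intros n; destruct (proj1 he (phi n)) as [h|h]; [|exact h].
      destruct (proj1 (hQ _ (hphiQ n)) h). }
    destruct (hc (fun n => e (phi n))) as [psi [y [hpsi hy]]].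
    { exists 1; intros n; rewrite hnorm_unit by apply hunit; lra. }
    assert (ha : 0 < Rabs lam) by (apply Rabs_pos_lt, hlam).
    destruct (hy (Rabs lam / 2) ltac:(lra)) as [N hN].
    pose proof (hN N ltac:(lia)) as h1; pose proof (hN (Datatypes.S N) ltac:(lia)) as h2.
    rewrite hnorm_sub_sym in h2; simpl in h1, h2.
    pose proof (hnorm_sub_triang (P (e (phi (psi N)))) y (P (e (phi (psi (Datatypes.S N)))))) as h3.
    assert (hPphi : forall n, P (e (phi n)) = hscal (RtoC lam) (e (phi n)))
      by (intros n; apply hQ, hphiQ).
    rewrite (hPphi (psi N)) in h1, h3; rewrite (hPphi (psi (Datatypes.S N))) in h2, h3.
    set (d := hsub (hscal (RtoC lam) (e (phi (psi N))))
      (hscal (RtoC lam) (e (phi (psi (Datatypes.S N)))))) in *.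
    assert (h4 : nsq d = 2 * (lam * lam)).
    { unfold d; rewrite nsq_sub, !nsq_scal, !hunit; autorewrite with ip.
      rewrite (proj2 he); [unfold Csq; simpl; ring|].
      pose proof (strictly_increasing_lt phi hphi _ _ (hpsi N)); lia. }
    rewrite <- hnorm_sqr in h4; pose proof (hnorm_ge0 d).
    assert (h5 : lam * lam = Rabs lam * Rabs lam).
    { rewrite <- Rabs_mult, Rabs_pos_eq; [reflexivity | nra]. }
    assert (h6 : hnorm d < Rabs lam) by lra.
    assert (hnorm d * hnorm d <= Rabs lam * Rabs lam) by (apply Rmult_le_compat; lra).
    nra. }
  destruct hN as [N hN].
  set (dec := fun n => if excluded_middle_informative (Q n) then true else false).
  exists (filter dec (seq 0 N)); split; [apply NoDup_filter, seq_NoDup|].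
  intros n; rewrite filter_In, in_seq; unfold dec.
  destruct (excluded_middle_informative (Q n)) as [h|h].
  - split; [intros _; exact h | intros _; split; [specialize (hN n h); lia | reflexivity]].
  - split; [intros [_ h1]; discriminate | intros h1; contradiction].
Qed.

(** * Dimensions of eigenspaces *)

Lemma expand_orth {H : Hilbert} (x y : H) (u : list H) :
  (forall v, In v u -> inner v y = C0) -> inner (expand x u) y = C0.
Proof.
  induction u as [|v u IH]; simpl; intros h; [apply inner_zerol|].
  autorewrite with ip; rewrite IH, h by auto; apply C_ext; simpl; ring.
Qed.

Lemma expand_zero {H : Hilbert} (x : H) (u : list H) :
  (forall v, In v u -> inner x v = C0) -> expand x u = hzero.
Proof.
  induction u as [|v u IH]; simpl; intros h; [reflexivity|].
  rewrite IH, h by auto; hring.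
Qed.

Lemma inner_expand_ons {H : Hilbert} (e : nat -> H) (l : list nat) (x : H) (m : nat) :
  ons e -> NoDup l -> In m l -> inner (expand x (map e l)) (e m) = inner x (e m).
Proof.
  intros he hl; induction hl as [|n l hn hl IH]; simpl; [tauto|]; intros hm.
  autorewrite with ip; destruct (PeanoNat.Nat.eq_dec n m) as [->|hnm].
  - rewrite inner_ons_absorb, expand_orth; [apply C_ext; simpl; ring | | exact he |].
    + intros v hv; apply in_map_iff in hv; destruct hv as [k [<- hk]].
      apply (proj2 he); intros ->; contradiction.
    + intros h; rewrite h; apply inner_zeror.
  - rewrite (proj2 he) by exact hnm; rewrite IH by (destruct hm; [contradiction | assumption]).
    apply C_ext; simpl; ring.
Qed.

(** Subtracting from [x] its expansion stays in [W] and leaves a vector orthogonal to all listed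
    [e n], which is zero by the last hypothesis. *)
Lemma has_dim_of_ons {H : Hilbert} (W : H -> Prop) (e : nat -> H) (l : list nat) :
  ons e -> NoDup l -> (forall n, In n l -> e n <> hzero /\ W (e n)) ->
  (forall x y, W x -> W y -> W (hsub x y)) -> (forall a x, W x -> W (hscal a x)) ->
  (forall x, W x -> (forall n, In n l -> inner x (e n) = C0) -> x = hzero) ->
  has_dim W (length l).
Proof.
  intros he hl hW hsub' hscal' h0; exists (map e l); split; [apply length_map|]; split; [|split].
  - intros i j hi hj; rewrite length_map in hi, hj.
    rewrite !(nth_indep _ hzero (e 0%nat)), !map_nth by (rewrite length_map; assumption).
    destruct (PeanoNat.Nat.eqb_spec i j) as [->|hij].
    + destruct (proj1 he (nth j l 0%nat)) as [h|h].
      * destruct (proj1 (hW _ (nth_In l 0%nat hj)) h).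
      * rewrite inner_self, h; reflexivity.
    + apply (proj2 he); intros h; apply hij, (proj1 (NoDup_nth l 0%nat) hl); assumption.
  - intros v hv; apply in_map_iff in hv; destruct hv as [n [<- hn]]; apply hW, hn.
  - intros x hx; apply hsub_eq0, h0.
    + assert (h : forall l', incl l' l -> W (hsub x (expand x (map e l')))).
      { induction l' as [|n l' IH]; simpl; intros hi.
        - replace (hsub x hzero) with x by hring; exact hx.
        - replace (hsub x (hadd (hscal (inner x (e n)) (e n)) (expand x (map e l'))))
            with (hsub (hsub x (expand x (map e l'))) (hscal (inner x (e n)) (e n))) by hring.
          apply hsub', hscal', hW, hi; [|left; reflexivity].
          apply IH; intros k hk; apply hi; right; exact hk. }
      apply h, incl_refl.
    + intros n hn; rewrite inner_subl, inner_expand_ons by assumption.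
      apply C_ext; simpl; ring.
Qed.

(** The default value [hzero] of [nth] is exactly the padding that [ons] permits, so Bessel's
    inequality becomes available for lists. *)
Lemma ons_of_orthonormal_list {H : Hilbert} (u : list H) :
  orthonormal_list u -> ons (fun i => nth i u hzero).
Proof.
  intros hu; split.
  - intros i; destruct (Compare_dec.lt_dec i (length u)) as [h|h].
    + right; unfold nsq; rewrite (hu i i h h), PeanoNat.Nat.eqb_refl; reflexivity.
    + left; apply nth_overflow; lia.
  - intros i j hij.
    destruct (Compare_dec.lt_dec i (length u)) as [h|h];
      [|rewrite nth_overflow by lia; apply inner_zerol].
    destruct (Compare_dec.lt_dec j (length u)) as [h'|h'];
      [|rewrite (nth_overflow u) with (n := j) by lia; apply inner_zeror].
    rewrite (hu i j h h'); destruct (PeanoNat.Nat.eqb_spec i j); [contradiction | reflexivity].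
Qed.

Lemma rsum_shift (a : nat -> R) (N : nat) :
  rsum a (Datatypes.S N) = a 0%nat + rsum (fun n => a (Datatypes.S n)) N.
Proof. induction N as [|N IH]; [simpl; ring|]; simpl in *; lra. Qed.

Lemma Re_inner_expand {H : Hilbert} (x : H) (u : list H) :
  Re (inner x (expand x u)) = rsum (fun j => Csq (inner x (nth j u hzero))) (length u).
Proof.
  induction u as [|v u IH]; [simpl; rewrite inner_zeror; reflexivity|].
  change (length (v :: u)) with (Datatypes.S (length u)); rewrite rsum_shift; simpl nth.
  rewrite <- IH; simpl expand; autorewrite with ip; unfold Csq; simpl; ring.
Qed.

(** Double counting of [|<u_i, v_j>|^2]: the sum over [j] is 1, because [u_i] is its own expansion
    in [v], and the sum over [i] is at most 1 by Bessel. *)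
Lemma has_dim_le {H : Hilbert} (W : H -> Prop) (k m : nat) :
  has_dim W k -> has_dim W m -> (k <= m)%nat.
Proof.
  intros [u [<- [hu [huW _]]]] [v [<- [hv [_ hspan]]]].
  pose proof (ons_of_orthonormal_list u hu) as hU; pose proof (ons_of_orthonormal_list v hv) as hV.
  apply INR_le.
  rewrite <- (Rmult_1_r (INR (length u))), <- (Rmult_1_r (INR (length v))), <- !rsum_const.
  apply Rle_trans with
    (rsum (fun i => rsum (fun j => Csq (inner (nth i u hzero) (nth j v hzero))) (length v))
      (length u)).
  - apply rsum_le; intros i hi; rewrite <- Re_inner_expand, <- hspan.
    + rewrite (hu i i hi hi), PeanoNat.Nat.eqb_refl; simpl; lra.
    + apply huW, nth_In, hi.
  - rewrite rsum_exchange; apply rsum_le; intros j hj.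
    rewrite (rsum_ext _ (fun i => Csq (inner (nth j v hzero) (nth i u hzero))))
      by (intros; apply Csq_inner_sym).
    eapply Rle_trans; [apply (Bessel _ (nth j v hzero) (length u) hU)|].
    apply (ons_nsq_le1 _ j hV).
Qed.

Lemma has_dim_unique {H : Hilbert} (W : H -> Prop) (k m : nat) :
  has_dim W k -> has_dim W m -> k = m.
Proof. intros hk hm; apply PeanoNat.Nat.le_antisymm; eapply has_dim_le; eassumption. Qed.

Lemma eigenspace_sub {H : Hilbert} (P : H -> H) (a : C) : linear_op P ->
  forall x y, P x = hscal a x -> P y = hscal a y -> P (hsub x y) = hscal a (hsub x y).
Proof. intros hl x y hx hy; rewrite (linear_op_sub P hl), hx, hy; hring. Qed.

Lemma eigenspace_scal {H : Hilbert} (P : H -> H) (a : C) : linear_op P ->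
  forall b x, P x = hscal a x -> P (hscal b x) = hscal a (hscal b x).
Proof. intros hl b x hx; rewrite (proj2 hl), hx; hring. Qed.

(** [singular_values] equates counts with dimensions but asserts the existence of neither;
    compactness supplies the dimension, by making a maximal orthonormal system in the eigenspace
    finite. *)
Lemma eigenspace_has_dim {H : Hilbert} (P : H -> H) (lam : R) :
  separable H -> compact_op P -> lam <> 0 ->
  exists k, has_dim (fun x => P x = hscal (RtoC lam) x) k.
Proof.
  intros hs hc hlam.
  destruct (maximal_ons (fun x => P x = hscal (RtoC lam) x) hs) as [e [he [hQ hm]]].
  destruct (eigenvalue_finite_multiplicity P e lam (fun n => e n <> hzero) hc he hlam)
    as [l [hl hin]]; [auto|].
  exists (length l); apply (has_dim_of_ons _ e l he hl).
  - intros n hn; apply hin in hn; auto.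
  - apply eigenspace_sub, hc.
  - apply eigenspace_scal, hc.
  - intros x hx hx0; apply NNPP; intros hne.
    apply (hm _ (nsq_normalize x hne)).
    + apply eigenspace_scal; [apply hc | exact hx].
    + intros n; rewrite inner_scall.
      destruct (classic (e n = hzero)) as [h|h].
      * rewrite h, inner_zeror; apply C_ext; simpl; ring.
      * rewrite hx0 by (apply hin, h); apply C_ext; simpl; ring.
Qed.

Definition pad (D : nat -> bool) (s : nat -> R) (n : nat) : R := if D n then s n else 0.

Lemma nsq_modulus {H : Hilbert} (T A P : H -> H) :
  adjoint_of T A -> self_adjoint P -> (forall x, P (P x) = A (T x)) ->
  forall x, nsq (P x) = nsq (T x).
Proof. intros hA hP h x; unfold nsq; rewrite hA, <- h, hP; reflexivity. Qed.

Lemma eigenvectors_orth {H : Hilbert} (P : H -> H) (x y : H) (a b : R) :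
  self_adjoint P -> P x = hscal (RtoC a) x -> P y = hscal (RtoC b) y -> a <> b -> inner x y = C0.
Proof.
  intros hP hx hy hab; pose proof (hP x y) as h; rewrite hx, hy in h.
  autorewrite with ip in h.
  apply C_ext; [apply (f_equal Re) in h | apply (f_equal Im) in h]; simpl in *;
    (apply (Rmult_eq_reg_l (a - b)); [|lra]); lra.
Qed.

(** For each [lam > 0] there are as many indices with value [lam] as vectors in an orthonormal basis
    of that eigenspace of [P], so the two are paired by position. The second family is orthonormal
    because [<T e_n, T e_m> = s_m^2 <e_n, e_m>]. *)
Lemma svd_of_singular_values {H : Hilbert} (T : H -> H) (D : nat -> bool) (s : nat -> R) :
  separable H -> compact_op T -> singular_values T D s ->
  exists e sg, svd T (pad D s) e sg /\ forall k, inner (T (e k)) (sg k) = RtoC (pad D s k).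
Proof.
  intros hsep hcT [A [P [hA [[hPl [hPsa hPpos]] [hPP [hs hcount]]]]]].
  pose proof (nsq_modulus T A P hA hPsa hPP) as hnorm.
  pose proof (compact_of_same_norm T P hcT hPl hnorm) as hcP.
  (* [F lam] will hold the indices with value [lam] and a basis of the eigenspace. It is chosen once
     per value, so that indices with equal values draw from the same basis. *)
  assert (hF : forall lam, exists lu : list nat * list H, 0 < lam ->
    NoDup (fst lu) /\ (forall n, In n (fst lu) <-> D n = true /\ s n = lam) /\
    length (fst lu) = length (snd lu) /\ orthonormal_list (snd lu) /\
    (forall v, In v (snd lu) -> P v = hscal (RtoC lam) v) /\
    (forall x, P x = hscal (RtoC lam) x -> x = expand x (snd lu))).
  { intros lam; destruct (Rlt_dec 0 lam) as [h|h]; [|exists (nil, nil); intros; contradiction].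
    destruct (eigenspace_has_dim P lam hsep hcP) as [k hk]; [lra|].
    pose proof (proj2 (hcount lam h k) hk) as [l [hl [hlk hlin]]].
    destruct hk as [u [huk hu]].
    exists (l, u); intros _; simpl; split; [exact hl|]; split; [exact hlin|].
    split; [congruence | exact hu]. }
  apply functional_choice in hF; destruct hF as [F hF].
  assert (hE : forall n, exists v, if D n then
    exists i, (i < length (fst (F (s n))))%nat /\ nth i (fst (F (s n))) 0%nat = n /\
      v = nth i (snd (F (s n))) hzero else v = hzero).
  { intros n; destruct (D n) eqn:hD; [|exists hzero; reflexivity].
    destruct (hF (s n) (hs n hD)) as [_ [hin _]].
    destruct (In_nth (fst (F (s n))) n 0%nat) as [i [hi1 hi2]]; [apply hin; auto|].
    eexists; exists i; eauto. }
  apply functional_choice in hE; destruct hE as [e he].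
  assert (hP : forall n, P (e n) = hscal (RtoC (pad D s n)) (e n)).
  { intros n; specialize (he n); unfold pad; destruct (D n) eqn:hD.
    - destruct he as [i [hi [_ ->]]].
      destruct (hF (s n) (hs n hD)) as [_ [_ [hlen [_ [hv _]]]]].
      apply hv, nth_In; rewrite <- hlen; exact hi.
    - rewrite he, (linear_op_zero P hPl), hscal_zero; reflexivity. }
  assert (hons : ons e).
  { split.
    - intros n; specialize (he n); destruct (D n) eqn:hD; [right|left; exact he].
      destruct he as [i [hi [_ ->]]].
      destruct (hF (s n) (hs n hD)) as [_ [_ [hlen [ho _]]]]; rewrite hlen in hi.
      unfold nsq; rewrite (ho i i hi hi), PeanoNat.Nat.eqb_refl; reflexivity.
    - intros n m hnm.
      pose proof (he n) as hn; destruct (D n) eqn:hDn; [|rewrite hn; apply inner_zerol].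
      pose proof (he m) as hm; destruct (D m) eqn:hDm; [|rewrite hm; apply inner_zeror].
      (* Equal values give different positions in one orthonormal basis; different values give
         eigenvectors of a self-adjoint operator for different eigenvalues. *)
      destruct (Req_dec (s n) (s m)) as [hsnm|hsnm].
      + destruct hn as [i [hi [hin ->]]], hm as [j [hj [hjm ->]]].
        rewrite hsnm in *.
        destruct (hF (s m) (hs m hDm)) as [_ [_ [hlen [ho _]]]]; rewrite hlen in hi, hj.
        rewrite (ho i j hi hj); destruct (PeanoNat.Nat.eqb_spec i j) as [->|]; [|reflexivity].
        exfalso; apply hnm; congruence.
      + apply (eigenvectors_orth P (e n) (e m) (pad D s n) (pad D s m)); auto.
        unfold pad; rewrite hDn, hDm; exact hsnm. }
  (* Otherwise [P] has an eigenvector [z] orthogonal to all [e n], with [lam > 0] by positivity. The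
     basis of that eigenspace consists of vectors [e n], so the expansion of [z] in it is zero. *)
  assert (hker : forall x, (forall n, inner x (e n) = C0) -> P x = hzero).
  { intros x hx; apply NNPP; intros hne.
    destruct (eigenvector_exists P e hcP hPsa) as [z [lam [hlam [hz1 [hz0 hz]]]]].
    - intros y hy n; rewrite hPsa, hP, inner_scalr, hy; apply C_ext; simpl; ring.
    - exists x; auto.
    - assert (hlp : 0 < lam).
      { pose proof (hPpos z) as h; rewrite hz, inner_scall, inner_self, hz1 in h; simpl in h; lra. }
      destruct (hF lam hlp) as [hnd [hin [hlen [_ [_ hspan]]]]].
      assert (hz' : z = hzero).
      { rewrite (hspan z hz); apply expand_zero; intros v hv.
        destruct (In_nth _ v hzero hv) as [i [hi hiv]]; rewrite <- hlen in hi.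
        set (n := nth i (fst (F lam)) 0%nat).
        assert (hn : D n = true /\ s n = lam) by (apply hin, nth_In, hi).
        destruct hn as [hD hsn]; pose proof (he n) as hen; rewrite hD in hen.
        destruct hen as [j [hj [hjn hej]]]; rewrite hsn in *.
        assert (hij : j = i) by (apply (proj1 (NoDup_nth _ 0%nat) hnd); auto).
        rewrite <- hiv, <- hij, <- hej; apply hz0. }
      rewrite hz', nsq_zero in hz1; lra. }
  exists e, (fun n => if D n then hscal (RtoC (/ s n)) (T (e n)) else hzero).
  destruct hcT as [hTl _].
  assert (hTT : forall n m, inner (T (e n)) (T (e m)) =
    Cmul (RtoC (pad D s m * pad D s m)) (inner (e n) (e m))).
  { intros n m; rewrite hA, <- hPP, hP, (proj2 hPl), hP; autorewrite with ip.
    apply C_ext; simpl; ring. }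
  assert (hTe : forall k, T (e k) = hscal (RtoC (pad D s k))
    (if D k then hscal (RtoC (/ s k)) (T (e k)) else hzero)).
  { intros k; pose proof (he k) as hk; unfold pad; destruct (D k) eqn:hD.
    - rewrite <- hscal_mul; replace (Cmul (RtoC (s k)) (RtoC (/ s k))) with C1.
      + symmetry; apply hscal_one.
      + pose proof (hs k hD); apply C_ext; simpl; field; lra.
    - rewrite hk, (linear_op_zero T hTl), hscal_zero; reflexivity. }
  assert (hunit : forall n, D n = true -> nsq (e n) = 1).
  { intros n hD; pose proof (he n) as hn; rewrite hD in hn; destruct hn as [i [hi [_ ->]]].
    destruct (hF (s n) (hs n hD)) as [_ [_ [hlen [ho _]]]]; rewrite hlen in hi.
    unfold nsq; rewrite (ho i i hi hi), PeanoNat.Nat.eqb_refl; reflexivity. }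
  split; [split; [exact hons|]; split; [split|split; [|split]]|].
  - intros n; destruct (D n) eqn:hD; [right|left; reflexivity].
    pose proof (hs n hD); rewrite nsq_scal; unfold nsq; rewrite hTT, inner_self, (hunit n hD).
    unfold pad; rewrite hD; unfold Csq; simpl; field; lra.
  - intros n m hnm; destruct (D n); [|apply inner_zerol]; destruct (D m); [|apply inner_zeror].
    autorewrite with ip; rewrite hTT, (proj2 hons n m hnm); apply C_ext; simpl; ring.
  - intros k; unfold pad; destruct (D k) eqn:hD; [left; apply hs, hD | lra].
  - exact hTe.
  - intros x hx; apply nsq_eq0; rewrite <- hnorm, (hker x hx); apply nsq_zero.
  - intros k; destruct (D k) eqn:hD.
    + pose proof (hs k hD); rewrite inner_scalr, hTT, inner_self, (hunit k hD).
      unfold pad; rewrite hD; apply C_ext; simpl; field; lra.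
    + unfold pad; rewrite hD; apply inner_zeror.
Qed.

Lemma complete_ext {H : Hilbert} (g : nat -> H) (x y : H) :
  complete g -> (forall n, inner x (g n) = inner y (g n)) -> x = y.
Proof.
  intros hc h; apply hsub_eq0, hc; intros n; rewrite inner_subl, h; apply C_ext; simpl; ring.
Qed.

(** A bounded multiplier of Fourier coefficients, used to build the square root of [T^*T] in an
    eigenbasis. Self-adjointness and positivity pass to the limit from partial sums. *)
Lemma diagonal_positive_op {H : Hilbert} (g : nat -> H) (s : nat -> R) (K : R) :
  ons g -> complete g -> (forall n, 0 <= s n <= K) ->
  exists P, positive_op P /\ forall x n, inner (P x) (g n) = Cmul (RtoC (s n)) (inner x (g n)).
Proof.
  intros hg hc hs.
  assert (hP : forall x, exists y, forall n, inner y (g n) = Cmul (RtoC (s n)) (inner x (g n))).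
  { intros x.
    destruct (Riesz_Fischer (fun n => Cmul (RtoC (s n)) (inner x (g n))) g (K * K * nsq x) hg)
      as [y [_ hy]].
    - intros N; apply Rle_trans with (rsum (fun n => K * K * Csq (inner x (g n))) N).
      + apply rsum_le; intros n _; specialize (hs n).
        pose proof (ons_nsq_le1 g n hg); pose proof (nsq_ge0 (g n)).
        pose proof (Csq_ge0 (inner x (g n))).
        replace (Csq (Cmul (RtoC (s n)) (inner x (g n)))) with (s n * s n * Csq (inner x (g n)))
          by (unfold Csq; simpl; ring).
        assert (s n * s n <= K * K) by nra.
        assert (0 <= s n * s n * Csq (inner x (g n))) by (apply Rmult_le_pos; nra).
        nra.
      + rewrite rsum_scal; apply Rmult_le_compat_l; [|apply Bessel, hg].
        specialize (hs 0%nat); nra.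
    - exists y; intros n; rewrite hy; apply inner_ons_absorb; [exact hg|].
      intros h; rewrite h, inner_zeror; apply C_ext; simpl; ring. }
  apply functional_choice in hP; destruct hP as [P hP]; exists P; split; [split; [|split]|exact hP].
  - split; intros; apply (complete_ext g); try exact hc; intros n; rewrite hP;
      autorewrite with ip; rewrite !hP; apply C_ext; simpl; ring.
  - intros x y.
    apply (inner_lim_eq (comb (fun n => inner (P x) (g n)) g) (comb (fun n => inner x (g n)) g));
      try (apply fourier_conv; assumption).
    induction n as [|n IH]; simpl; [rewrite !inner_zerol; reflexivity|].
    autorewrite with ip; rewrite IH, hP, (inner_conj H y (g n)), (inner_conj H (P y) (g n)), hP.
    apply C_ext; simpl; ring.
  - intros x; apply (Re_inner_lim_ge0 (comb (fun n => inner (P x) (g n)) g));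
      [apply fourier_conv; assumption|].
    induction n as [|n IH]; simpl; [rewrite inner_zerol; simpl; lra|].
    autorewrite with ip; rewrite hP, (inner_conj H x (g n)); simpl.
    specialize (hs n); pose proof (Csq_ge0 (inner x (g n))) as h; unfold Csq in h; nra.
Qed.

Lemma singular_values_exist {H : Hilbert} (T : H -> H) :
  separable H -> compact_op T -> exists D s, singular_values T D s.
Proof.
  intros hsep hc; destruct (compact_bounded T hc) as [K hK].
  destruct (adjoint_exists T K hsep (proj1 hc) hK) as [A hA].
  pose proof (adjoint_linear T A hA) as hAl.
  pose proof (adjoint_bounded T A K hA hK) as hAK.
  destruct (eigenbasis_exists (fun x => A (T x)) hsep) as [g [mu [hg [hcm hmu]]]].
  { apply (compact_comp_l A T K); assumption. }
  { intros x y; rewrite (adjoint_of_sym T A hA), hA; reflexivity. }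
  (* For a unit eigenvector of [A T] the eigenvalue is [<A T g_n, g_n> = |T g_n|^2], so this norm is
     its square root; at padded indices it is 0. *)
  set (s := fun n => hnorm (T (g n))).
  assert (hsg : forall n, A (T (g n)) = hscal (RtoC (s n * s n)) (g n)).
  { intros n; unfold s; rewrite hnorm_sqr, hmu.
    destruct (proj1 hg n) as [h|h]; [rewrite h, !hscal_zero; reflexivity|].
    unfold nsq; rewrite hA, hmu, inner_scalr, inner_self, h; simpl.
    f_equal; apply C_ext; simpl; ring. }
  assert (hs : forall n, 0 <= s n <= K).
  { intros n; split; [apply hnorm_ge0|]; unfold s.
    pose proof (proj2 hK (g n)) as h; pose proof (ons_nsq_le1 g n hg) as h1.
    rewrite <- hnorm_sqr in h1; pose proof (hnorm_ge0 (g n)); pose proof (proj1 hK).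
    assert (hnorm (g n) <= 1) by nra; nra. }
  destruct (diagonal_positive_op g s K hg hcm hs) as [P [hP hPg]].
  assert (hPP : forall x, P (P x) = A (T x)).
  { intros x; apply (complete_ext g); [exact hcm|]; intros n.
    rewrite !hPg, (adjoint_of_sym T A hA), hA, hsg, inner_scalr; apply C_ext; simpl; ring. }
  assert (hPe : forall n, P (g n) = hscal (RtoC (s n)) (g n)).
  { intros n; apply (complete_ext g); [exact hcm|]; intros m; rewrite hPg, inner_scall.
    destruct (PeanoNat.Nat.eq_dec n m) as [->|h]; [reflexivity|].
    rewrite (proj2 hg n m h); apply C_ext; simpl; ring. }
  assert (hcP : compact_op P).
  { apply (compact_of_same_norm T P hc (proj1 hP)).
    apply (nsq_modulus T A P hA (proj1 (proj2 hP)) hPP). }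
  set (D := fun n => if Rlt_dec 0 (s n) then true else false).
  assert (hD : forall n, D n = true <-> 0 < s n).
  { intros n; unfold D; destruct (Rlt_dec 0 (s n)); split; intros; congruence || auto. }
  exists D, s, A, P; split; [exact hA|]; split; [exact hP|]; split; [exact hPP|].
  split; [intros n; apply hD|].
  intros lam hlam k.
  assert (hne : forall n, s n = lam -> g n <> hzero).
  { intros n hn h; unfold s in hn.
    rewrite h, (linear_op_zero T (proj1 hc)), hnorm_zero in hn; lra. }
  assert (hcd : forall l, NoDup l -> (forall n, In n l <-> D n = true /\ s n = lam) ->
    has_dim (fun x => P x = hscal (RtoC lam) x) (length l)).
  { intros l hl hin; apply (has_dim_of_ons _ g l hg hl).
    - intros n hn; apply hin in hn; destruct hn as [_ hn]; split; [apply hne, hn|].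
      rewrite hPe, hn; reflexivity.
    - apply eigenspace_sub, hP.
    - apply eigenspace_scal, hP.
    - intros x hx hx0; apply hcm; intros n.
      destruct (Req_dec (s n) lam) as [h|h].
      + apply hx0, hin; split; [apply hD; lra | exact h].
      + pose proof (hPg x n) as h1; rewrite hx, inner_scall in h1.
        apply C_ext; [apply (f_equal Re) in h1 | apply (f_equal Im) in h1]; simpl in *;
          (apply (Rmult_eq_reg_l (s n - lam)); [|lra]); lra. }
  split.
  - intros [l [hl [<- hin]]]; apply hcd; assumption.
  (* The given dimension comes with no index list: finite multiplicity provides one, and uniqueness
     of the dimension shows that its length is [k]. *)
  - intros hk.
    destruct (eigenvalue_finite_multiplicity P g lam (fun n => D n = true /\ s n = lam) hcP hg)
      as [l [hl hin]]; [lra| |].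
    + intros n [_ hn]; split; [apply hne, hn | rewrite hPe, hn; reflexivity].
    + exists l; split; [exact hl|]; split; [|exact hin].
      exact (has_dim_unique _ _ _ (hcd l hl hin) hk).
Qed.

(** * Bases and frames *)

Lemma psum_pad (D : nat -> bool) (a : nat -> R) (N : nat) : psum D a N = rsum (pad D a) N.
Proof. induction N as [|N IH]; simpl; [reflexivity|]; rewrite IH; reflexivity. Qed.

Lemma esum_le_rsum (D : nat -> bool) (a b : nat -> R) (M : R) :
  (forall n, pad D a n = b n) -> (esum_le D a M <-> forall N, rsum b N <= M).
Proof.
  intros h; assert (hN : forall N, psum D a N = rsum b N).
  { intros N; rewrite psum_pad; apply rsum_ext; auto. }
  split; intros hM N; specialize (hM N); rewrite hN in *; exact hM.
Qed.

(** The convention [rpow 0 p = 0] makes padded indices drop out of the sum. *)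
Lemma esum_le_singular (D : nat -> bool) (s : nat -> R) (p M : R) :
  esum_le D (fun n => rpow (s n) p) M <-> forall N, rsum (fun n => rpow (pad D s n) p) N <= M.
Proof.
  apply esum_le_rsum; intros n; unfold pad; destruct (D n); [|rewrite rpow_0]; reflexivity.
Qed.

Definition hpad {H : Hilbert} (D : nat -> bool) (e : nat -> H) (n : nat) : H :=
  if D n then e n else hzero.

Lemma ONB_hpad {H : Hilbert} (D : nat -> bool) (e : nat -> H) :
  ONB D e -> ons (hpad D e) /\ complete (hpad D e).
Proof.
  unfold hpad; intros [ho hc]; split; [split|].
  - intros n; destruct (D n) eqn:hD; [right|left; reflexivity].
    unfold nsq; rewrite (ho n n hD hD), PeanoNat.Nat.eqb_refl; reflexivity.
  - intros n m hnm; destruct (D n) eqn:hn; [|apply inner_zerol].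
    destruct (D m) eqn:hm; [|apply inner_zeror].
    rewrite (ho n m hn hm); destruct (PeanoNat.Nat.eqb_spec n m); [contradiction | reflexivity].
  - intros x hx; apply hc; intros n hn; specialize (hx n); rewrite hn in hx; exact hx.
Qed.

Lemma ONB_of_complete_ons {H : Hilbert} (g : nat -> H) :
  ons g -> complete g -> exists D, ONB D g /\ forall n, hpad D g n = g n.
Proof.
  intros hg hc; exists (fun n => if excluded_middle_informative (g n = hzero) then false else true).
  split; [split|].
  - intros n m hn _; destruct (PeanoNat.Nat.eqb_spec n m) as [<-|h]; [|apply hg, h].
    destruct (excluded_middle_informative (g n = hzero)) as [h0|h0]; [discriminate|].
    destruct (proj1 hg n) as [h|h]; [contradiction|]; rewrite inner_self, h; reflexivity.
  - intros x hx; apply hc; intros n; specialize (hx n).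
    destruct (excluded_middle_informative (g n = hzero)) as [h0|h0]; [|apply hx; reflexivity].
    rewrite h0; apply inner_zeror.
  - intros n; unfold hpad; destruct (excluded_middle_informative (g n = hzero)); congruence.
Qed.

Definition qf {H : Hilbert} (p : R) (T : H -> H) (f : nat -> H) (n : nat) : R :=
  rpow (Cmod (inner (T (f n)) (f n))) p.

Lemma esum_le_qf_hpad {H : Hilbert} (p M : R) (T : H -> H) (D : nat -> bool) (e : nat -> H) :
  esum_le D (qf p T e) M <-> forall N, rsum (qf p T (hpad D e)) N <= M.
Proof.
  apply esum_le_rsum; intros n; unfold pad, hpad, qf; destruct (D n); [reflexivity|].
  rewrite inner_zeror, Cmod_C0, rpow_0; reflexivity.
Qed.

Lemma esum_le_qf_allN {H : Hilbert} (p M : R) (T : H -> H) (f : nat -> H) :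
  esum_le allN (qf p T f) M <-> forall N, rsum (qf p T f) N <= M.
Proof. apply esum_le_rsum; reflexivity. Qed.

Lemma rsum_qf_of_ONB {H : Hilbert} (p M : R) (T : H -> H) (g : nat -> H) (D : nat -> bool) :
  (forall n, hpad D g n = g n) -> esum_le D (qf p T g) M -> forall N, rsum (qf p T g) N <= M.
Proof.
  intros h hM N; rewrite (rsum_ext _ (qf p T (hpad D g))).
  - revert N; apply esum_le_qf_hpad, hM.
  - intros n _; unfold qf; rewrite h; reflexivity.
Qed.

Lemma sum_f_R0_rsum (a : nat -> R) (n : nat) : sum_f_R0 a n = rsum a (Datatypes.S n).
Proof. induction n as [|n IH]; [simpl; ring|]; simpl in *; rewrite IH; reflexivity. Qed.

Lemma frame_bounds_rsum {H : Hilbert} (f : nat -> H) (c1 c2 : R) : frame_bounds f c1 c2 ->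
  forall x N, rsum (fun n => Csq (inner x (f n))) N <= c2 * nsq x.
Proof.
  intros [_ [_ h]] x N; destruct (h x) as [l [hl [_ hle]]]; rewrite hnorm_sqr in hle.
  eapply Rle_trans; [|exact hle].
  apply Rle_trans with (rsum (fun n => Csq (inner x (f n))) (Datatypes.S N)).
  - apply rsum_mono; [intros; apply Csq_ge0 | lia].
  - rewrite (rsum_ext _ (fun n => Cmod (inner x (f n)) * Cmod (inner x (f n))))
      by (intros; symmetry; apply Cmod_sqr).
    rewrite <- sum_f_R0_rsum; apply sum_incr; [exact hl|].
    intros n; apply Rmult_le_pos; apply Cmod_ge0.
Qed.

Lemma complete_ons_tight_frame {H : Hilbert} (g : nat -> H) :
  ons g -> complete g -> frame_bounds g 1 1.
Proof.
  intros hg hc; split; [lra|]; split; [lra|]; intros x; exists (nsq x).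
  rewrite hnorm_sqr; split; [|lra].
  intros eps he; destruct (Parseval g x hg hc eps he) as [N hN].
  exists N; intros n hn; rewrite sum_f_R0_rsum.
  rewrite (rsum_ext _ (fun n => Csq (inner x (g n)))) by (intros; apply Cmod_sqr).
  specialize (hN (Datatypes.S n) ltac:(lia)).
  pose proof (Bessel g x (Datatypes.S n) hg).
  unfold Rdist; apply Rabs_def1; lra.
Qed.

Lemma complete_ons_upper_frame_bound {H : Hilbert} (g : nat -> H) :
  ons g -> complete g -> upper_frame_bound_le g 1.
Proof.
  intros hg hc; pose proof (complete_ons_tight_frame g hg hc) as h.
  split; [exists 1, 1; exact h|]; intros eps he; exists 1, 1; split; [exact h | lra].
Qed.

Lemma upper_frame_bound_contractive {H : Hilbert} (f : nat -> H) :
  upper_frame_bound_le f 1 -> contractive_Bessel f.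
Proof.
  intros [_ h] x N; apply Rnot_lt_le; intros hlt.
  pose proof (nsq_ge0 x) as h0.
  set (r := rsum (fun n => Csq (inner x (f n))) N) in *.
  (* The margin is chosen so that an admissible [c2] below 1 plus this quotient gives
     [c2 * nsq x < r]; the denominator [nsq x + 1] stays positive for [x = hzero]. *)
  assert (he : 0 < (r - nsq x) / (nsq x + 1)) by (apply Rdiv_lt_0_compat; lra).
  destruct (h _ he) as [c1 [c2 [hf hc]]].
  pose proof (frame_bounds_rsum f c1 c2 hf x N) as h1; fold r in h1.
  assert (h2 : (r - nsq x) / (nsq x + 1) * (nsq x + 1) = r - nsq x) by (field; lra).
  nra.
Qed.

(** * Diagonal sums and the Schatten class *)

(** The signs of the real eigenvalues are moved into [sg]. The values are written as diagonal
    entries rather than [Rabs (al k)], so that they vanish at padded indices and their powers are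
    literally the terms of [qf]. *)
Lemma svd_selfadjoint {H : Hilbert} (T : H -> H) :
  separable H -> compact_op T -> self_adjoint T ->
  exists g sg, ons g /\ complete g /\ svd T (fun k => Cmod (inner (T (g k)) (g k))) g sg.
Proof.
  intros hs hc hsa; destruct (eigenbasis_exists T hs hc hsa) as [g [al [hg [hcm hal]]]].
  assert (hsgn : forall n, exists r, r * r = 1 /\ Rabs (al n) * r = al n).
  { intros n; unfold Rabs; destruct Rcase_abs; [exists (-1) | exists 1]; split; ring. }
  apply functional_choice in hsgn; destruct hsgn as [r hr].
  exists g, (fun n => hscal (RtoC (r n)) (g n)); split; [exact hg|]; split; [exact hcm|].
  split; [exact hg|]; split; [split|split; [|split]].
  - intros n; destruct (proj1 hg n) as [h|h]; [left; rewrite h; apply hscal_zero|right].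
    rewrite nsq_scal, h; unfold Csq; simpl; rewrite (proj1 (hr n)); ring.
  - intros n m hnm; autorewrite with ip; rewrite (proj2 hg n m hnm); apply C_ext; simpl; ring.
  - intros n; apply Cmod_ge0.
  - intros n; rewrite hal, inner_scall, Cmod_mul, Cmod_RtoC.
    destruct (proj1 hg n) as [h|h]; [rewrite h, !hscal_zero; reflexivity|].
    rewrite inner_self, h, Cmod_RtoC, Rabs_R1, Rmult_1_r, <- hscal_mul; f_equal.
    apply C_ext; simpl; rewrite ?(proj2 (hr n)); ring.
  - intros x hx; rewrite (hcm x hx); apply linear_op_zero, hc.
Qed.

Lemma selfadjoint_rpow_bound {H : Hilbert} (T : H -> H) (p : R) :
  separable H -> 1 <= p -> compact_op T -> self_adjoint T ->
  exists g, ons g /\ complete g /\ forall M, (forall N, rsum (qf p T g) N <= M) ->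
    forall u v, contractive_Bessel u -> contractive_Bessel v ->
    forall N, rsum (fun n => rpow (Cmod (inner (T (u n)) (v n))) p) N <= M.
Proof.
  intros hs hp hc hsa; destruct (svd_selfadjoint T hs hc hsa) as [g [sg [hg [hcm hsvd]]]].
  destruct (compact_bounded T hc) as [K hK].
  exists g; split; [exact hg|]; split; [exact hcm|]; intros M hM u v hu hv.
  apply (svd_rpow_bound T K p M _ g sg u v hp (proj1 hc) hK hsvd hu hv hM).
Qed.

(** Dividing the frame by [sqrt c2] makes its Bessel bound 1; the form is quadratic in the frame
    vectors, so undoing this costs [c2] per entry and [rpow c2 p] in the sum. *)
Lemma Sp_frame_sum_finite {H : Hilbert} (T : H -> H) (p : R) (f : nat -> H) :
  separable H -> 1 <= p -> in_Sp p T -> frame f ->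
  exists M, forall N, rsum (qf p T f) N <= M.
Proof.
  intros hs hp [hc [D [s [hsv [M hM]]]]] [c1 [c2 hf]].
  destruct (svd_of_singular_values T D s hs hc hsv) as [e [sg [hsvd _]]].
  destruct (compact_bounded T hc) as [K hK].
  rewrite esum_le_singular in hM.
  assert (hc2 : 0 < c2) by (destruct hf as [? [? _]]; lra).
  set (r := / sqrt c2).
  assert (hr : r * r = / c2).
  { unfold r; rewrite <- Rinv_mult, sqrt_sqrt by lra; reflexivity. }
  set (f' := fun n => hscal (RtoC r) (f n)).
  assert (hf' : contractive_Bessel f').
  { intros x N; rewrite (rsum_ext _ (fun n => / c2 * Csq (inner x (f n)))).
    - rewrite rsum_scal; pose proof (frame_bounds_rsum f c1 c2 hf x N) as h.
      apply (Rmult_le_compat_l (/ c2)) in h; [|left; apply Rinv_0_lt_compat, hc2].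
      rewrite <- Rmult_assoc, Rinv_l, Rmult_1_l in h by lra; exact h.
    - intros n _; unfold f'; rewrite inner_scalr, <- hr; unfold Csq; simpl; ring. }
  pose proof (svd_rpow_bound T K p M _ e sg f' f' hp (proj1 hc) hK hsvd hf' hf' hM) as h.
  exists (rpow c2 p * M); intros N.
  rewrite (rsum_ext _ (fun n => rpow c2 p * rpow (Cmod (inner (T (f' n)) (f' n))) p)).
  - rewrite rsum_scal; apply Rmult_le_compat_l; [apply rpow_ge0 | apply h].
  - intros n _; rewrite <- rpow_mul by (lra || apply Cmod_ge0); unfold qf; f_equal.
    unfold f'.
    rewrite (proj2 (proj1 hc)), inner_scall, inner_scalr, !Cmod_mul, Cmod_conj, Cmod_RtoC.
    replace (c2 * (Rabs r * (Rabs r * Cmod (inner (T (f n)) (f n)))))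
      with (c2 * (Rabs r * Rabs r) * Cmod (inner (T (f n)) (f n))) by ring.
    rewrite <- Rabs_mult, hr, Rabs_pos_eq by (left; apply Rinv_0_lt_compat, hc2).
    rewrite Rinv_r by lra; ring.
Qed.

Definition Ci : C := mkC 0 1.

(* [T = A + i B] with [A], [B] self-adjoint; both inherit the hypothesis on their own
   eigenbases, and [s_k = <T e_k, sg_k>] is split accordingly. *)
Lemma Sp_of_complete_ons_sums {H : Hilbert} (T : H -> H) (p : R) :
  separable H -> 1 <= p -> compact_op T ->
  (forall g, ons g -> complete g -> exists M, forall N, rsum (qf p T g) N <= M) -> in_Sp p T.
Proof.
  intros hs hp hc hg; split; [exact hc|].
  destruct (compact_bounded T hc) as [K hK].
  destruct (adjoint_exists T K hs (proj1 hc) hK) as [Ta hTa].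
  pose proof (adjoint_of_sym T Ta hTa) as hTa'.
  pose proof (adjoint_compact T Ta hc hTa) as hca.
  set (A := fun x => hadd (hscal (RtoC (/ 2)) (T x)) (hscal (RtoC (/ 2)) (Ta x))).
  set (B := fun x => hadd (hscal (mkC 0 (- / 2)) (T x)) (hscal (mkC 0 (/ 2)) (Ta x))).
  assert (hA : compact_op A)
    by (apply (compact_add (fun x => hscal _ (T x))); apply compact_scal; assumption).
  assert (hB : compact_op B)
    by (apply (compact_add (fun x => hscal _ (T x))); apply compact_scal; assumption).
  assert (hAs : self_adjoint A).
  { intros x y; unfold A; autorewrite with ip; rewrite hTa, hTa'; apply C_ext; simpl; ring. }
  assert (hBs : self_adjoint B).
  { intros x y; unfold B; autorewrite with ip; rewrite hTa, hTa'; apply C_ext; simpl; ring. }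
  (* As [<A x, x>] and [<B x, x>] are the real and imaginary parts of [<T x, x>], a diagonal sum of
     [T] dominates those of [A] and [B] over the same basis. *)
  assert (hAx : forall x, inner (A x) x = RtoC (Re (inner (T x) x))).
  { intros x; unfold A; autorewrite with ip; rewrite hTa', (inner_conj H (T x) x).
    apply C_ext; simpl; field. }
  assert (hBx : forall x, inner (B x) x = RtoC (Im (inner (T x) x))).
  { intros x; unfold B; autorewrite with ip; rewrite hTa', (inner_conj H (T x) x).
    apply C_ext; simpl; field. }
  destruct (selfadjoint_rpow_bound A p hs hp hA hAs) as [g1 [hg1 [hg1c h1]]].
  destruct (selfadjoint_rpow_bound B p hs hp hB hBs) as [g2 [hg2 [hg2c h2]]].
  destruct (hg g1 hg1 hg1c) as [M1 hM1], (hg g2 hg2 hg2c) as [M2 hM2].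
  specialize (h1 M1); specialize (h2 M2).
  destruct (singular_values_exist T hs hc) as [D [s hsv]].
  destruct (svd_of_singular_values T D s hs hc hsv) as [e [sg [[he [hsg [hs0 _]]] hk]]].
  exists D, s; split; [exact hsv|]; exists (rpow 2 p * (M1 + M2)).
  apply esum_le_singular; intros N.
  assert (hN1 : rsum (fun n => rpow (Cmod (inner (A (e n)) (sg n))) p) N <= M1).
  { apply h1; try (apply ons_contractive_Bessel; assumption).
    intros L; eapply Rle_trans; [|apply (hM1 L)]; apply rsum_le; intros n _.
    unfold qf; rewrite hAx, Cmod_RtoC; apply rpow_mono; [lra | apply Cmod_Re]. }
  assert (hN2 : rsum (fun n => rpow (Cmod (inner (B (e n)) (sg n))) p) N <= M2).
  { apply h2; try (apply ons_contractive_Bessel; assumption).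
    intros L; eapply Rle_trans; [|apply (hM2 L)]; apply rsum_le; intros n _.
    unfold qf; rewrite hBx, Cmod_RtoC; apply rpow_mono; [lra | apply Cmod_Im]. }
  apply Rle_trans with (rsum (fun n => rpow 2 p * (rpow (Cmod (inner (A (e n)) (sg n))) p +
    rpow (Cmod (inner (B (e n)) (sg n))) p)) N).
  - apply rsum_le; intros n _.
    eapply Rle_trans; [|apply rpow_add_le; [lra | apply Cmod_ge0 | apply Cmod_ge0]].
    apply rpow_mono; [lra|].
    rewrite <- (Rabs_pos_eq (pad D s n)), <- Cmod_RtoC, <- hk by apply hs0.
    replace (T (e n)) with (hadd (A (e n)) (hscal Ci (B (e n)))).
    + rewrite inner_addl, inner_scall; eapply Rle_trans; [apply Cmod_triang|].
      rewrite Cmod_mul; replace (Cmod Ci) with 1; [lra|].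
      unfold Cmod; simpl; replace (0 * 0 + 1 * 1) with 1 by ring; symmetry; apply sqrt_1.
    + unfold A, B; apply inner_ext; intros z; autorewrite with ip; apply C_ext; simpl; field.
  - rewrite rsum_scal, rsum_plus; apply Rmult_le_compat_l; [apply rpow_ge0 | lra].
Qed.

(** Each equality with a supremum is expressed by having the same upper bounds [M], which also
    covers infinite values; it is asserted for every enumeration of the singular values. *)
Theorem theorem7 (H : Hilbert) (p : R) (S : H -> H) :
  separable H -> 1 <= p -> compact_op S ->
  ((in_Sp p S <->
      (forall (D : nat -> bool) (e : nat -> H), ONB D e ->
         in_lp p D (fun n => inner (S (e n)) (e n)))) /\
   (in_Sp p S <->
      (forall f : nat -> H, frame f ->
         in_lp p allN (fun n => inner (S (f n)) (f n))))) /\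
  (self_adjoint S ->
   forall (D : nat -> bool) (s : nat -> R), singular_values S D s ->
   forall M : R,
     (esum_le D (fun n => rpow (s n) p) M <->
        (forall (D' : nat -> bool) (e : nat -> H), ONB D' e ->
           esum_le D' (fun n => rpow (Cmod (inner (S (e n)) (e n))) p) M)) /\
     (esum_le D (fun n => rpow (s n) p) M <->
        (forall f : nat -> H, upper_frame_bound_le f 1 ->
           esum_le allN (fun n => rpow (Cmod (inner (S (f n)) (f n))) p) M))).
Proof.
  intros hs hp hc; split; [split; split|].
  - intros hS D e he; destruct (ONB_hpad D e he) as [ho hcm].
    destruct (Sp_frame_sum_finite S p (hpad D e) hs hp hS) as [M hM].
    + exists 1, 1; apply complete_ons_tight_frame; assumption.
    + exists M; apply (esum_le_qf_hpad p M S D e), hM.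
  - intros h; apply (Sp_of_complete_ons_sums S p hs hp hc); intros g hg hcm.
    destruct (ONB_of_complete_ons g hg hcm) as [D [hD hpad']].
    destruct (h D g hD) as [M hM]; exists M; apply (rsum_qf_of_ONB p M S g D hpad' hM).
  - intros hS f hf; destruct (Sp_frame_sum_finite S p f hs hp hS hf) as [M hM].
    exists M; apply (esum_le_qf_allN p M S f), hM.
  - intros h; apply (Sp_of_complete_ons_sums S p hs hp hc); intros g hg hcm.
    destruct (h g) as [M hM].
    + exists 1, 1; apply complete_ons_tight_frame; assumption.
    + exists M; apply esum_le_qf_allN, hM.
  - intros hsa D s hsv M.
    destruct (svd_of_singular_values S D s hs hc hsv) as [e [sg [hsvd hk]]].
    destruct (compact_bounded S hc) as [K hK].
    assert (hup : forall f, contractive_Bessel f -> esum_le D (fun n => rpow (s n) p) M ->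
      forall N, rsum (qf p S f) N <= M).
    { intros f hf hM; apply (svd_rpow_bound S K p M (pad D s) e sg f f hp (proj1 hc) hK hsvd hf hf).
      apply esum_le_singular, hM. }
    (* The hypothesis is used only at the eigenbasis of [S]; the resulting bound is transferred to
       the pair [e], [sg], whose entries are the singular values themselves. *)
    assert (hdown : (forall g, ons g -> complete g -> forall N, rsum (qf p S g) N <= M) ->
      esum_le D (fun n => rpow (s n) p) M).
    { intros h; destruct (selfadjoint_rpow_bound S p hs hp hc hsa) as [g [hg [hcm hb]]].
      destruct hsvd as [he [hsg [hs0 _]]].
      apply esum_le_singular; intros N.
      eapply Rle_trans; [|apply (hb M (h g hg hcm) e sg); apply ons_contractive_Bessel; assumption].
      apply rsum_le; intros n _; rewrite hk, Cmod_RtoC, Rabs_pos_eq by apply hs0; lra. }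
    split; split.
    + intros hM D' f hf; destruct (ONB_hpad D' f hf) as [ho _].
      apply (esum_le_qf_hpad p M S D' f), hup; [apply ons_contractive_Bessel, ho | exact hM].
    + intros h; apply hdown; intros g hg hcm.
      destruct (ONB_of_complete_ons g hg hcm) as [D' [hD' hpad']].
      apply (rsum_qf_of_ONB p M S g D' hpad' (h D' g hD')).
    + intros hM f hf; apply (esum_le_qf_allN p M S f), hup; [|exact hM].
      apply upper_frame_bound_contractive, hf.
    (* A padded orthonormal basis is itself a frame with both bounds 1, so the frame condition
       contains the basis condition. *)
    + intros h; apply hdown; intros g hg hcm.
      apply esum_le_qf_allN, (h g (complete_ons_upper_frame_bound g hg hcm)).
Qed.
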